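(* As $k\to\infty$, \[ R(3,k)\geq \Big(\frac{1}{3}+o(1)\Big)\frac{k^2}{\log k}. \] Equivalently, for every $\varepsilon>0$ and all sufficiently large $k$, there exists a triangle-free graph on at least $(1/3-\varepsilon)k^2/\log k$ vertices containing no independent set of size $k$.
   Context: $R(3,k)$ denotes the Ramsey number: the least $n$ such that every graph on $n$ vertices contains either a triangle or an independent set of size $k$. Logarithms are natural. *)

(* Defs.v *)
From mathcomp Require Import all_boot.
Set Implicit Arguments. Unset Strict Implicit. Unset Printing Implicit Defensive.

Definition simple_graph (n : nat) (e : rel 'I_n) : Prop :=
  symmetric e /\ irreflexive e.

Definition has_triangle (n : nat) (e : rel 'I_n) : Prop :=
  exists x y z : 'I_n, [&& e x y, e y z & e x z].

Definition independent (n : nat) (e : rel 'I_n) (S : {set 'I_n}) : Prop :=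
  forall x y, x \in S -> y \in S -> ~~ e x y.

(* ramsey3 n k : every graph on n vertices contains a triangle or an
   independent set of size k.  R(3,k) is the least n with ramsey3 n k. *)
Definition ramsey3 (n k : nat) : Prop :=
  forall e : rel 'I_n, simple_graph e ->
    has_triangle e \/ exists S : {set 'I_n}, independent e S /\ #|S| = k.

(* Main.v *)
Require Import Defs.
From mathcomp Require Import all_boot all_order all_algebra.
From mathcomp Require Import unstable reals sequences exp ring lra zify.
Set Implicit Arguments. Unset Strict Implicit. Unset Printing Implicit Defensive.
Import Order.TTheory GRing.Theory Num.Theory.
Local Open Scope ring_scope.

(** Random blocks: the [n] vertices are projected twice, independently and
    uniformly, onto a set of [m] blocks with [m] smaller than [n] by a power of
    [log k]; two independent random graphs of density [p = (5/4) log k / k], one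
    red and one blue, live on the blocks and are pulled back to the vertices. In
    a reduced graph two blocks typically have no common neighbour, so very few
    edges are lost when one deletes every edge whose ends have a common neighbour
    in the other colour, or a common neighbour of their own colour in a block
    larger than both; by pigeonhole the remaining graph is triangle-free.

    Let [I] be an independent [k]-set, projecting onto [jR] red and [jB] blue
    blocks. All red edges between its red blocks were deleted. Pairs of blocks
    are closed either lightly, in which case only few of them carry an edge, or
    because they lie in one of boundedly many blue neighbourhoods that meet [I] in
    a positive proportion. Each neighbourhood has at most [0.43 k] vertices, and
    the part of [I] inside them meets few blue blocks, hence has at most
    [k - jB + o(k)] elements; so at most [0.43 k (k - jB + o(k)) / 2] pairs are
    closed in this way, and the others carry few red edges. The same holds
    with the colours exchanged, and the two events are independent. On the other
    side, random projections make sets with few blocks rare: there are about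
    [exp ((jR + jB - k) log k)] sets with these block numbers. With
    [a = 1 - jB / k] the union bound succeeds because
    [5/8 ((1 - a)^2 - 0.43 a) + a > 1/2] on [[0, 1]]. *)

(** * Finite probability spaces *)

Record distr (R : realDomainType) (T : finType) := Distr {
  mass :> T -> R;
  mass_ge0 : forall t, 0 <= mass t;
  mass_sum1 : \sum_t mass t = 1 }.

Section Expectation.
Variables (R : realDomainType) (T : finType) (d : distr R T).
Implicit Types (f g : T -> R) (P Q : pred T) (c : R).

Definition Ex f : R := \sum_t d t * f t.
Definition Pr P : R := Ex (fun t => (P t)%:R).

Lemma eq_Ex f g : f =1 g -> Ex f = Ex g.
Proof. by move=> fg; apply: eq_bigr => t _; rewrite fg. Qed.

Lemma ExD f g : Ex (fun t => f t + g t) = Ex f + Ex g.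
Proof. by rewrite -big_split; apply: eq_bigr => t _; rewrite mulrDr. Qed.

Lemma ExZ c f : Ex (fun t => c * f t) = c * Ex f.
Proof. by rewrite big_distrr; apply: eq_bigr => t _; rewrite mulrCA. Qed.

Lemma Ex_sum (I : Type) (r : seq I) (K : pred I) (F : I -> T -> R) :
  Ex (fun t => \sum_(i <- r | K i) F i t) = \sum_(i <- r | K i) Ex (F i).
Proof.
by rewrite /Ex exchange_big; apply: eq_bigr => t _; rewrite big_distrr.
Qed.

Lemma Ex_cst c : Ex (fun=> c) = c.
Proof. by rewrite /Ex -big_distrl /= mass_sum1 mul1r. Qed.

Lemma ler_Ex f g : (forall t, f t <= g t) -> Ex f <= Ex g.
Proof. by move=> fg; apply: ler_sum => t _; rewrite ler_wpM2l ?mass_ge0. Qed.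

Lemma Ex_ge0 f : (forall t, 0 <= f t) -> 0 <= Ex f.
Proof. by move=> f0; rewrite -(Ex_cst 0) ler_Ex. Qed.

Lemma Ex_lt_exists f c : Ex f < c -> exists t, f t < c.
Proof.
move=> fc; apply/existsP; apply: contraTT fc; rewrite negb_exists -leNgt.
by move=> /forallP cf; rewrite -[c]Ex_cst ler_Ex // => t; rewrite leNgt.
Qed.

Lemma Pr_ge0 P : 0 <= Pr P.
Proof. by apply: Ex_ge0 => t; rewrite ler0n. Qed.

Lemma ler_Pr P Q : (forall t, P t -> Q t) -> Pr P <= Pr Q.
Proof.
by move=> PQ; apply: ler_Ex => t; case: (boolP (P t)) => [/PQ ->|_] //; exact: ler0n.
Qed.

Lemma Pr_markov P f :
  (forall t, 0 <= f t) -> (forall t, P t -> 1 <= f t) -> Pr P <= Ex f.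
Proof. by move=> f0 Pf; apply: ler_Ex => t; case: (boolP (P t)) => [/Pf|_]. Qed.

Lemma Pr_exists_le (I : finType) (K : pred I) P (Q : I -> pred T) :
  (forall t, P t -> exists2 i, K i & Q i t) -> Pr P <= \sum_(i | K i) Pr (Q i).
Proof.
move=> PQ; rewrite -Ex_sum; apply: Pr_markov => t => [|/PQ[i Ki Qi]].
  by apply: sumr_ge0 => i _; rewrite ler0n.
by rewrite (bigD1 i) //= Qi lerDl sumr_ge0.
Qed.

Lemma Pr_exists_le_card (I : finType) (Q : I -> pred T) c :
  (forall i, Pr (Q i) <= c) -> Pr (fun t => [exists i, Q i t]) <= #|I|%:R * c.
Proof.
move=> Qc; rewrite mulr_natl -sumr_const; apply: le_trans (ler_sum _ (fun i _ => Qc i)).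
by apply: Pr_exists_le => t /existsP[i Qi]; exists i.
Qed.

Lemma PrU_le P Q a b :
  Pr P <= a -> Pr Q <= b -> Pr (fun t => P t || Q t) <= a + b.
Proof.
move=> Pa Qb; apply: le_trans (lerD Pa Qb); rewrite -ExD.
apply: Pr_markov => t; first by rewrite addr_ge0.
by case/orP=> ->; rewrite ?lerDl ?lerDr.
Qed.

Lemma Pr_lt1 P : Pr P < 1 -> exists t, ~~ P t.
Proof. by case/Ex_lt_exists=> t Pt; exists t; apply: contraTN Pt => ->; rewrite ltxx. Qed.

End Expectation.

Section ProductDistribution.
Variables (R : realDomainType) (T1 T2 : finType).
Variables (d1 : distr R T1) (d2 : distr R T2).

Let prod_mass (z : T1 * T2) := d1 z.1 * d2 z.2.

Lemma prod_mass_ge0 z : 0 <= prod_mass z.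
Proof. by rewrite mulr_ge0 ?mass_ge0. Qed.

Lemma prod_mass_sum1 : \sum_z prod_mass z = 1.
Proof.
rewrite -(pair_bigA _ (fun x y => d1 x * d2 y)) /= -(mass_sum1 d1).
by apply: eq_bigr => x _; rewrite -big_distrr /= mass_sum1 mulr1.
Qed.

Definition prod_distr := Distr prod_mass_ge0 prod_mass_sum1.

Lemma Ex_prod_distr f :
  Ex prod_distr f = Ex d1 (fun x => Ex d2 (fun y => f (x, y))).
Proof.
transitivity (\sum_x \sum_y d1 x * d2 y * f (x, y)).
  by rewrite pair_bigA; apply: eq_bigr => -[].
by apply: eq_bigr => x _; rewrite big_distrr; apply: eq_bigr => y _; rewrite /= mulrA.
Qed.

Lemma Ex_prod_distrM f g :
  Ex prod_distr (fun z => f z.1 * g z.2) = Ex d1 f * Ex d2 g.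
Proof.
by rewrite Ex_prod_distr mulrC -ExZ; apply: eq_Ex => x; rewrite mulrC -ExZ.
Qed.

Lemma Pr_prod_distrM (P : pred T1) (Q : pred T2) :
  Pr prod_distr (fun z => P z.1 && Q z.2) = Pr d1 P * Pr d2 Q.
Proof. by rewrite -Ex_prod_distrM; apply: eq_Ex => z; rewrite -natrM mulnb. Qed.

Lemma Pr_prod_distr_le2 (P : pred (T1 * T2)) c :
  (forall x, Pr d2 (fun y => P (x, y)) <= c) -> Pr prod_distr P <= c.
Proof. by move=> Pc; rewrite /Pr Ex_prod_distr -[leRHS](Ex_cst d1); apply: ler_Ex. Qed.

End ProductDistribution.

Section ProductSwap.
Variables (R : realDomainType) (T1 T2 : finType).
Variables (d1 : distr R T1) (d2 : distr R T2).

Lemma Ex_prod_distrC f :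
  Ex (prod_distr d1 d2) f = Ex (prod_distr d2 d1) (fun z => f (z.2, z.1)).
Proof.
rewrite !Ex_prod_distr /Ex; under eq_bigr do rewrite big_distrr /=.
rewrite exchange_big; apply: eq_bigr => y _; rewrite big_distrr /=.
by apply: eq_bigr => x _; rewrite mulrCA.
Qed.

Lemma Pr_prod_distr_le1 (P : pred (T1 * T2)) c :
  (forall y, Pr d1 (fun x => P (x, y)) <= c) -> Pr (prod_distr d1 d2) P <= c.
Proof. by rewrite /Pr Ex_prod_distrC; exact: Pr_prod_distr_le2. Qed.

End ProductSwap.

(** * Independent coordinates *)

Definition depends_on (A T : finType) (U : Type) (G : pred A)
    (f : {ffun A -> T} -> U) :=
  forall w w' : {ffun A -> T}, (forall a, G a -> w a = w' a) -> f w = f w'.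

Section IndependentCoordinates.
Variables (R : realDomainType) (A T : finType) (d : distr R T).
Implicit Types (w : {ffun A -> T}) (f g : {ffun A -> T} -> R).

Let ffun_mass w := \prod_a d (w a).

Lemma ffun_mass_ge0 w : 0 <= ffun_mass w.
Proof. by apply: prodr_ge0 => a _; exact: mass_ge0. Qed.

Lemma ffun_mass_sum1 : \sum_w ffun_mass w = 1.
Proof.
by rewrite -(bigA_distr_bigA (fun=> d)) big1 // => a _; exact: mass_sum1.
Qed.

Definition ffun_distr := Distr ffun_mass_ge0 ffun_mass_sum1.
Local Notation E := (Ex ffun_distr).

(* Swapping the coordinates outside [G] between two independent samples
   preserves their joint distribution. *)
Lemma Ex_indep (G : pred A) f g :
  depends_on G f -> depends_on (predC G) g -> E (fun w => f w * g w) = E f * E g.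
Proof.
move=> Gf Gg.
pose mix w w' := [ffun a => if G a then w a else w' a].
pose swap (z : {ffun A -> T} * {ffun A -> T}) := (mix z.1 z.2, mix z.2 z.1).
have swapK : involutive swap.
  by move=> [w w']; congr pair; apply/ffunP => a; rewrite !ffunE /=; case: (G a).
have mass_swap z : prod_distr ffun_distr ffun_distr (swap z) =
    prod_distr ffun_distr ffun_distr z.
  rewrite /= /ffun_mass -!big_split; apply: eq_bigr => a _ /=; rewrite !ffunE.
  by case: (G a); rewrite // mulrC.
have -> : E (fun w => f w * g w) =
    Ex (prod_distr ffun_distr ffun_distr) (fun z => f z.1 * g z.1).
  by rewrite Ex_prod_distr; apply: eq_Ex => w /=; rewrite Ex_cst.
rewrite -Ex_prod_distrM [RHS](reindex_inj (inv_inj swapK)).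
apply: eq_bigr => -[w w'] _; rewrite mass_swap; congr (_ * (_ * _)).
- by apply: Gf => a Ga; rewrite ffunE Ga.
- by apply: Gg => a /negPf Ga; rewrite ffunE Ga.
Qed.

Lemma Ex_prod_seq_indep (I : eqType) (r : seq I) (G : I -> pred A)
    (F : I -> {ffun A -> T} -> R) :
  uniq r -> (forall i, i \in r -> depends_on (G i) (F i)) ->
  (forall i j a, i \in r -> j \in r -> G i a -> G j a -> i = j) ->
  E (fun w => \prod_(i <- r) F i w) = \prod_(i <- r) E (F i).
Proof.
elim: r => [|i r IH] /= => [_ _ _|/andP[ir ur] dF dG].
  by rewrite big_nil -[RHS](Ex_cst ffun_distr); apply: eq_Ex => w; exact: big_nil.
rewrite big_cons -IH //; last first.
- by move=> j l a jr lr; apply: dG; rewrite inE ?jr ?lr orbT.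
- by move=> j jr; apply: dF; rewrite inE jr orbT.
rewrite -(@Ex_indep (G i)); last 2 first.
- by apply: dF; rewrite inE eqxx.
- move=> w w' ww'; apply: eq_big_seq => j jr.
  apply: (dF j); first by rewrite inE jr orbT.
  move=> a Ga; apply: ww'; apply: contraNN ir => Gi.
  by rewrite (dG i j a) // !inE ?eqxx ?jr ?orbT.
by apply: eq_Ex => w; rewrite big_cons.
Qed.

Lemma Ex_prod_indep (I : finType) (K : pred I) (G : I -> pred A)
    (F : I -> {ffun A -> T} -> R) :
  (forall i, K i -> depends_on (G i) (F i)) ->
  (forall i j a, K i -> K j -> G i a -> G j a -> i = j) ->
  E (fun w => \prod_(i | K i) F i w) = \prod_(i | K i) E (F i).
Proof.
move=> dF dG; rewrite -big_enum -(Ex_prod_seq_indep (G := G)) ?enum_uniq //.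
- by apply: eq_Ex => w; rewrite big_enum.
- by move=> i; rewrite mem_enum; exact: dF.
- by move=> i j a; rewrite !mem_enum; exact: dG.
Qed.

Lemma Ex_coord a (h : T -> R) : E (fun w => h (w a)) = Ex d h.
Proof.
pose F b t := d t * (if b == a then h t else 1).
transitivity (\prod_b \sum_t F b t).
  rewrite bigA_distr_bigA; apply: eq_bigr => w _; rewrite /F big_split /=.
  by rewrite -big_mkcond big_pred1_eq.
rewrite (bigD1 a) //= /F eqxx [X in _ * X]big1 ?mulr1 // => b /negPf ->.
by under eq_bigr do rewrite mulr1; exact: mass_sum1.
Qed.

Lemma Ex_prod_coord (I : finType) (K : pred I) (coord : I -> A)
    (h : I -> T -> R) :
  {in K &, injective coord} ->
  E (fun w => \prod_(i | K i) h i (w (coord i))) = \prod_(i | K i) Ex d (h i).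
Proof.
move=> coordI; rewrite (Ex_prod_indep (G := fun i => pred1 (coord i))).
- by apply: eq_bigr => i _; rewrite Ex_coord.
- by move=> i _ w w' ww'; rewrite ww' //=.
- by move=> i j a Ki Kj /= /eqP -> /eqP; exact: coordI.
Qed.

Lemma Ex_gated_le (e : A) (X : {ffun A -> T} -> bool) (h : T -> R) f :
  depends_on (predC1 e) X -> depends_on (predC1 e) f ->
  (forall w, 0 <= f w) -> Ex d h <= 1 ->
  E (fun w => (if X w then h (w e) else 1) * f w) <= E f.
Proof.
move=> dX df f0 h1.
rewrite (@eq_Ex _ _ _ _
  (fun w => h (w e) * ((X w)%:R * f w) + (~~ X w)%:R * f w)); last first.
  by move=> w; case: (X w); rewrite /= ?mul0r ?mulr0 ?addr0 ?add0r ?mul1r.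
rewrite ExD (@Ex_indep (pred1 e)); last 2 first.
- by move=> w w' ww'; rewrite ww' /=.
- by move=> w w' ww'; rewrite (dX w w') // (df w w').
rewrite Ex_coord (@le_trans _ _ (1 * E (fun w => (X w)%:R * f w) +
  E (fun w => (~~ X w)%:R * f w))) //.
  by rewrite lerD2r ler_wpM2r // Ex_ge0 // => w; rewrite mulr_ge0.
rewrite mul1r -ExD; apply: ler_Ex => w.
by case: (X w); rewrite /= ?mul0r ?addr0 ?add0r mul1r.
Qed.

(* Integrate out the coordinates by increasing height: each factor has
   conditional expectation at most one given the higher coordinates. *)
Lemma Ex_predictable_prod_le1 (ht : A -> nat)
    (X : A -> {ffun A -> T} -> bool) (h : A -> T -> R) :
  (forall e, depends_on (fun a => ht e < ht a)%N (X e)) ->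
  (forall e t, 0 <= h e t) -> (forall e, Ex d (h e) <= 1) ->
  E (fun w => \prod_e (if X e w then h e (w e) else 1)) <= 1.
Proof.
move=> dX h0 h1; pose ht_le a b := (ht a <= ht b)%N.
have ht_le_trans : transitive ht_le by move=> x y z; exact: leq_trans.
pose s := sort ht_le (enum A).
rewrite (@eq_Ex _ _ _ _
  (fun w => \prod_(e <- s) (if X e w then h e (w e) else 1))); last first.
  by move=> w; rewrite [RHS](perm_big (enum A)) ?perm_sort //= big_enum.
have : uniq s by rewrite sort_uniq enum_uniq.
have : sorted ht_le s by apply: sort_sorted => a b; exact: leq_total.
elim: s => [|e s IH] /= => [_ _|path_es /andP[es us]].
  by rewrite (@eq_Ex _ _ _ _ (fun=> 1)) ?Ex_cst // => w; rewrite big_nil.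
have lowest_e := order_path_min ht_le_trans path_es.
have ne_higher b a : b \in e :: s -> (ht b < ht a)%N -> a != e.
  rewrite inE => bs; apply: contraTneq => ->; rewrite -leqNgt.
  by case/orP: bs => [/eqP ->|/(allP lowest_e)].
apply: le_trans (IH (path_sorted path_es) us).
under eq_Ex do rewrite big_cons.
apply: Ex_gated_le => //.
- move=> w w' ww'; apply: dX => a ha.
  by apply: ww'; apply: ne_higher ha; rewrite inE eqxx.
- move=> w w' ww'; apply: eq_big_seq => b bs.
  rewrite ww' /= ?(contraTneq _ bs) // => [|->//].
  rewrite (dX b w w') // => a ha.
  by apply: ww'; apply: ne_higher ha; rewrite inE bs orbT.
- by move=> w; apply: prodr_ge0 => a _; case: ifP.
Qed.

End IndependentCoordinates.

(** * Exponential inequalities *)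

Section ExponentialInequalities.
Variable R : realType.
Implicit Types (x : R) (i : nat).

Lemma expR_ge1 x : 0 <= x -> 1 <= expR x.
Proof. by move=> x0; rewrite -expR0 ler_expR. Qed.

Lemma expR_leV x : x < 1 -> expR x <= (1 - x)^-1.
Proof.
move=> x1; rewrite -[x in expR x]opprK expRN lef_pV2 ?posrE ?expR_gt0 ?subr_gt0 //.
exact: expR_ge1Dx.
Qed.

Lemma expRN_leV x : 0 < x -> expR (- x) <= x^-1.
Proof.
move=> x0; rewrite expRN lef_pV2 ?posrE ?expR_gt0 //.
by apply: le_trans (expR_ge1Dx x); rewrite lerDr.
Qed.

Lemma expR_le1DMexpR x : expR x <= 1 + x * expR x.
Proof.
have := expR_ge1Dx (- x); rewrite -(ler_pM2l (expR_gt0 x)) expRxMexpNx_1; lra.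
Qed.

Lemma expR_le_quadratic x : 0 <= x -> x <= 2^-1 -> expR x <= 1 + x + 2 * x ^+ 2.
Proof.
move=> x0 x2; apply: (le_trans (expR_leV _)); first lra.
rewrite -div1r ler_pdivrMr; nra.
Qed.

Lemma expR_le_affine x : 0 <= x -> x <= 2^-1 -> expR x <= 1 + 2 * x.
Proof. by move=> x0 x2; apply: (le_trans (expR_le_quadratic x0 x2)); nra. Qed.

Lemma expR1_le4 : expR (1 : R) <= 4.
Proof.
have -> : (1 : R) = 2^-1 + 2^-1 by lra.
have sqrt_e : expR (2^-1 : R) <= 2.
  by apply: (le_trans (expR_le_affine _ _)); rewrite ?lexx //; lra.
rewrite expRD; have := expR_gt0 (2^-1 : R); nra.
Qed.

Lemma expR_ge_exprn i : exists2 x0 : R, 0 <= x0 & forall x, x0 <= x -> x ^+ i <= expR x.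
Proof.
have f_gt0 : 0 < i.+1`!%:R :> R by rewrite ltr0n fact_gt0.
exists i.+1`!%:R => [|x le_x]; first exact: ltW.
have x0 : 0 <= x by apply: le_trans le_x; exact: ltW.
apply: le_trans (expR_ge1Dxn i x0); apply: (@le_trans _ _ (x ^+ i.+1 / i.+1`!%:R)).
  by rewrite ler_pdivlMr // exprSr ler_wpM2l // exprn_ge0.
by rewrite lerDr.
Qed.

Lemma ffact_le_expn a b : (a ^_ b <= a ^ b)%N.
Proof. by elim: b => // b IH; rewrite ffactnSr expnSr leq_mul // leq_subr. Qed.

Lemma expn_le_factMexpR b : b%:R ^+ b <= b`!%:R * expR b%:R :> R.
Proof.
case: b => [|b]; first by rewrite expR0 mulr1.
have b0 : 0 < b.+1`!%:R :> R by rewrite ltr0n fact_gt0.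
rewrite mulrC -ler_pdivrMr //; apply: le_trans (expR_ge1Dxn b (ler0n _ _)).
by rewrite lerDr.
Qed.

Lemma bin_le_expR a b : (0 < b)%N ->
  'C(a, b)%:R <= (a%:R / b%:R) ^+ b * expR b%:R :> R.
Proof.
move=> b0; rewrite expr_div_n mulrAC ler_pdivlMr ?exprn_gt0 ?ltr0n //.
apply: le_trans (ler_wpM2l (ler0n _ _) (expn_le_factMexpR b)) _.
by rewrite mulrA ler_wpM2r ?expR_ge0 // -natrM bin_ffact -natrX ler_nat ffact_le_expn.
Qed.

End ExponentialInequalities.

(** * Tail bounds *)

Lemma natr_card_set (R : pzSemiRingType) (T : finType) (K P : pred T) :
  #|[set x | K x && P x]|%:R = \sum_(x | K x) (P x)%:R :> R.
Proof.
rewrite -sum1_card natr_sum big_mkcond [RHS]big_mkcond; apply: eq_bigr => x _.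
by rewrite inE; case: (K x); case: (P x).
Qed.

Lemma Pr_chernoff (R : realType) (T : finType) (d : distr R T) (X : T -> R) (z : R) :
  Pr d (fun t => z <= X t) <= expR (- z) * Ex d (fun t => expR (X t)).
Proof.
rewrite -ExZ; apply: Pr_markov => t; first by rewrite mulr_ge0 ?expR_ge0.
by move=> zX; rewrite -expRD expR_ge1 // addrC subr_ge0.
Qed.

Section Bernoulli.
Variables (R : realType) (p : R).
Hypothesis p01 : 0 <= p <= 1.

Let bernoulli_mass (b : bool) : R := if b then p else 1 - p.

Lemma bernoulli_mass_ge0 b : 0 <= bernoulli_mass b.
Proof. by case/andP: p01 => p0 p1; case: b; rewrite //= subr_ge0. Qed.

Lemma bernoulli_mass_sum1 : \sum_b bernoulli_mass b = 1.
Proof. by rewrite big_bool /= addrC subrK. Qed.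

Definition bernoulli := Distr bernoulli_mass_ge0 bernoulli_mass_sum1.

Lemma Ex_bernoulli h : Ex bernoulli h = p * h true + (1 - p) * h false.
Proof. by rewrite /Ex big_bool. Qed.

Lemma bernoulli_mgf (t : R) :
  Ex bernoulli (fun b => expR (t * b%:R)) <= expR (p * (expR t - 1)).
Proof.
rewrite Ex_bernoulli mulr0 mulr1 expR0; apply: le_trans (expR_ge1Dx _); lra.
Qed.

Lemma bernoulli_marked_mgf (marked : bool) (s : R) : 0 <= s -> s <= 2^-1 ->
  Ex bernoulli (fun x => (if marked then x%:R else 1) * expR (s * x%:R)) <=
  (if marked then p * expR 2^-1 else 1) * expR (2 * (p * s)).
Proof.
case/andP: p01 => p_ge0 _ s0 s2; case: marked; last first.
  under eq_Ex do rewrite mul1r.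
  rewrite mul1r; apply: le_trans (bernoulli_mgf s) _; rewrite ler_expR.
  by have := ler_wpM2l p_ge0 (expR_le_affine s0 s2); lra.
rewrite Ex_bernoulli mulr1 mul1r mul0r mulr0 addr0 -mulrA ler_wpM2l //.
rewrite -expRD ler_expR; have := mulr_ge0 p_ge0 s0; lra.
Qed.

Section Tails.
Variable A : finType.
Local Notation Prb := (Pr (ffun_distr A bernoulli)).

Lemma bernoulli_sum_tail (I : finType) (K : pred I) (coord : I -> A)
    (v : I -> R) (z : R) :
  {in K &, injective coord} ->
  Prb (fun w => z <= \sum_(i | K i) v i * (w (coord i))%:R) <=
  expR (p * \sum_(i | K i) (expR (v i) - 1) - z).
Proof.
move=> coordI; apply: le_trans (Pr_chernoff _ _ _) _.
rewrite addrC expRD ler_wpM2l ?expR_ge0 // mulr_sumr expR_sum.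
under eq_Ex do rewrite expR_sum.
rewrite (Ex_prod_coord _ (fun i (b : bool) => expR (v i * b%:R)) coordI).
by apply: ler_prod => i _; rewrite bernoulli_mgf Ex_ge0 // => b; exact: expR_ge0.
Qed.

(* A negative [t] gives the lower tail. *)
Lemma bernoulli_card_tail (K : {set A}) (t z : R) :
  Prb (fun w => t * z <= t * #|[set a in K | w a]|%:R) <=
  expR (p * (expR t - 1) * #|K|%:R - t * z).
Proof.
have := @bernoulli_sum_tail _ (mem K) id (fun=> t) (t * z) (in2W (@inj_id A)).
rewrite sumr_const -[_ *+ _]mulr_natr mulrA; apply: le_trans; apply: ler_Pr => w.
by rewrite natr_card_set mulr_sumr.
Qed.

Lemma bernoulli_pair_mgf (a b : A) : a != b ->
  Ex (ffun_distr A bernoulli) (fun w => expR (w a && w b)%:R) <= expR (3 * p ^+ 2).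
Proof.
move=> ab; rewrite (@eq_Ex _ _ _ _
  (fun w : {ffun A -> bool} => 1 + (expR 1 - 1) * ((w a)%:R * (w b)%:R))); last first.
  by move=> w; case: (w a); case: (w b); rewrite /= ?expR0; lra.
rewrite ExD ExZ Ex_cst (@Ex_indep _ _ _ _ (pred1 a)); last 2 first.
- by move=> w w' ww'; rewrite ww' /=.
- by move=> w w' ww'; rewrite ww' //= eq_sym.
rewrite !(Ex_coord _ _ (fun x : bool => x%:R)) !Ex_bernoulli !mulr0 !mulr1 !addr0.
apply: le_trans (expR_ge1Dx _); rewrite lerD2l -expr2 ler_wpM2r ?sqr_ge0 //.
have := expR1_le4 R; lra.
Qed.

Lemma predictable_tail (ht : A -> nat) (X : A -> {ffun A -> bool} -> bool)
    (t c z : R) :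
  0 <= t -> (forall e, depends_on (fun a => ht e < ht a)%N (X e)) ->
  Prb (fun w => (#|[set e | X e w]|%:R <= c) &&
                (z <= #|[set e | X e w && w e]|%:R)) <=
  expR (p * (expR t - 1) * c - t * z).
Proof.
move=> t0 dX; set q := p * (expR t - 1).
have q0 : 0 <= q by case/andP: p01 => p0 _; rewrite mulr_ge0 // subr_ge0 expR_ge1.
pose h (e : A) (b : bool) := expR (t * b%:R - q).
have h1 e : Ex bernoulli (h e) <= 1.
  under eq_Ex do rewrite /h addrC expRD.
  by rewrite ExZ -[leRHS](expRxMexpNx_1 q) mulrC ler_wpM2r ?expR_ge0 ?bernoulli_mgf.
have mgf := Ex_predictable_prod_le1 dX (fun _ _ => expR_ge0 _) h1.
rewrite -[leRHS]mulr1; apply: le_trans (ler_wpM2l (expR_ge0 _) mgf).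
rewrite -ExZ; apply: Pr_markov => [w|w /andP[Xc zX]].
  rewrite mulr_ge0 ?expR_ge0 // prodr_ge0 // => e _.
  by case: ifP => // _; rewrite expR_ge0.
have -> : \prod_e (if X e w then h e (w e) else 1) =
    expR (t * #|[set e | X e w && w e]|%:R - q * #|[set e | X e w]|%:R).
  rewrite -big_mkcond -expR_sum big_split /= -mulr_sumr sumrN sumr_const.
  by rewrite (natr_card_set _ (fun e => X e w)) cardsE [q * _]mulr_natr.
rewrite -expRD expR_ge1 //.
have := ler_wpM2l t0 zX; have := ler_wpM2l q0 Xc; lra.
Qed.

End Tails.
End Bernoulli.

(** * Graphs on ['I_m] *)

(* Only the entries [(a, b)] with [a < b] carry information. *)
Local Notation graph m := {ffun 'I_m * 'I_m -> bool}.

Definition edge m (a b : 'I_m) : 'I_m * 'I_m := if (a < b)%N then (a, b) else (b, a).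
Definition adj m (g : graph m) (a b : 'I_m) := (a != b) && g (edge a b).

Section Graphs.
Variable m : nat.
Implicit Types (g : graph m) (a b c : 'I_m) (e : 'I_m * 'I_m) (J : {set 'I_m}).

Lemma edgeC a b : edge a b = edge b a.
Proof. by rewrite /edge; case: ltngtP => // /val_inj ->. Qed.

Lemma edge_injr b : injective (edge b).
Proof. by move=> a c; rewrite /edge; case: ifP; case: ifP => _ _ [] // -> ->. Qed.

Lemma edge_eq a b a' b' : edge a b = edge a' b' ->
  (a = a' /\ b = b') \/ (a = b' /\ b = a').
Proof. by rewrite /edge; case: ifP; case: ifP => _ _ [] -> ->; tauto. Qed.

Lemma edge_snd a b : (edge a b).2 = maxn a b :> nat.
Proof. by rewrite /edge; case: ltnP. Qed.

Lemma adjC g a b : adj g a b = adj g b a.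
Proof. by rewrite /adj eq_sym edgeC. Qed.

Lemma adj_irr g a : adj g a a = false.
Proof. by rewrite /adj eqxx. Qed.

Definition nbr g b := [set a | adj g b a].
Definition codeg g b c := #|nbr g b :&: nbr g c|.

Definition pairs J : {set 'I_m * 'I_m} :=
  [set e | [&& e.1 \in J, e.2 \in J & (e.1 < e.2)%N]].

Definition edges_in g J := [set e in pairs J | g e].

Lemma adj_pair g e : (e.1 < e.2)%N -> adj g e.1 e.2 = g e.
Proof. by case: e => a b /= ab; rewrite /adj /edge ab -val_eqE ltn_eqF. Qed.

Section PairSums.
Variable R : realFieldType.

Lemma sum_pairs J (F : 'I_m -> 'I_m -> R) : (forall a b, F a b = F b a) ->
  \sum_(a in J) \sum_(b in J | b != a) F a b = 2 * \sum_(e in pairs J) F e.1 e.2.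
Proof.
move=> FC.
have swapK : involutive (fun e : 'I_m * 'I_m => (e.2, e.1)) by case.
rewrite mulr_natl mulr2n pair_big_dep (bigID (fun e => e.1 < e.2)%N) /=.
congr (_ + _); last rewrite (reindex_inj (inv_inj swapK)) /=.
  by apply: eq_big => e; rewrite // inE -val_eqE /=; case: ltngtP; rewrite ?andbT ?andbF.
apply: eq_big => e; last by rewrite FC.
by rewrite inE -val_eqE /=; case: ltngtP; rewrite ?andbF //= !andbT andbC.
Qed.

Lemma card_pairs J : #|pairs J|%:R = (#|J|%:R ^+ 2 - #|J|%:R) / 2 :> R.
Proof.
have others a : a \in J -> \sum_(b in J | b != a) 1 = #|J|%:R - 1 :> R.
  move=> aJ; rewrite -[#|J|%:R]sumr_const [\sum_(_ in J) _](bigD1 a) //=.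
  by rewrite addrAC subrr add0r.
have := @sum_pairs J (fun _ _ => 1) (fun _ _ => erefl).
rewrite (eq_bigr _ others) !sumr_const -[_ *+ #|J|]mulr_natr; lra.
Qed.

Lemma sum_adj g J :
  \sum_(b in J) \sum_(a in J) (adj g b a)%:R = 2 * #|edges_in g J|%:R :> R.
Proof.
rewrite (natr_card_set _ (mem (pairs J))) /=.
rewrite (eq_bigr (fun e => (adj g e.1 e.2)%:R)); last first.
  by move=> e; rewrite inE => /and3P[_ _ /adj_pair ->].
rewrite -(sum_pairs _ (F := fun b a => (adj g b a)%:R)); last by move=> a b; rewrite adjC.
apply: eq_bigr => b _; rewrite [RHS]big_mkcondr; apply: eq_bigr => a _.
by case: eqP => // ->; rewrite adj_irr.
Qed.

End PairSums.

Section WeightedDegrees.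
Variables (R : realFieldType) (v : 'I_m -> R) (J : {set 'I_m}).
Hypothesis v_ge0 : forall a, 0 <= v a.

Definition wdeg g b : R := \sum_(a in J) v a * (adj g b a)%:R.

(* Paths [a, b, c] with both ends in [J], weighted by [v a * v c]. *)
Definition wcherry g b : R :=
  \sum_(a in J) \sum_(c in J | c != a) v a * v c * (adj g b a && adj g b c)%:R.

Definition light_wcherry (D : R) g b : R := if wdeg g b <= D then wcherry g b else 0.

Lemma wdeg_ge0 g b : 0 <= wdeg g b.
Proof. by apply: sumr_ge0 => a _; rewrite mulr_ge0. Qed.

Lemma wcherry_ge0 g b : 0 <= wcherry g b.
Proof. by apply: sumr_ge0 => a _; apply: sumr_ge0 => c _; rewrite !mulr_ge0. Qed.

Lemma wcherry_le g b : wcherry g b <= wdeg g b ^+ 2.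
Proof.
rewrite expr2 mulr_suml; apply: ler_sum => a aJ.
rewrite mulr_sumr big_mkcondr; apply: ler_sum => c cJ.
by rewrite mulrACA -natrM mulnb; case: ifP; rewrite // !mulr_ge0.
Qed.

Lemma light_wcherry_le D g b : 0 <= D -> light_wcherry D g b <= D * wdeg g b.
Proof.
move=> D0; rewrite /light_wcherry; case: ifP => [le_D|_].
  by apply: le_trans (wcherry_le _ _) _; rewrite expr2 ler_wpM2r ?wdeg_ge0.
by rewrite mulr_ge0 ?wdeg_ge0.
Qed.

Lemma sum_light_wcherry_le D vmax g : 0 <= D -> (forall a, v a <= vmax) ->
  \sum_(b in J) light_wcherry D g b <= 2 * D * vmax * #|edges_in g J|%:R.
Proof.
move=> D0 v_max; have -> : 2 * D * vmax * #|edges_in g J|%:R =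
  \sum_(b in J) D * \sum_(a in J) vmax * (adj g b a)%:R.
  rewrite -mulr_sumr; under eq_bigr do rewrite -mulr_sumr.
  by rewrite -mulr_sumr sum_adj; ring.
apply: ler_sum => b _; apply: le_trans (light_wcherry_le g b D0) _.
by rewrite ler_wpM2l //; apply: ler_sum => a _; rewrite ler_wpM2r.
Qed.

Definition star b : pred ('I_m * 'I_m) := [pred e | [exists a in J, e == edge b a]].

Lemma star_disjoint b b' e : b \notin J -> b' \notin J -> star b e -> star b' e -> b = b'.
Proof.
move=> bJ b'J /existsP[a /andP[aJ /eqP ->]] /existsP[a' /andP[a'J /eqP/edge_eq]].
by case=> [[]|[ba' _]] //; rewrite ba' a'J in bJ.
Qed.

Lemma light_wcherry_star D b : depends_on (star b) (fun g => light_wcherry D g b).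
Proof.
move=> g g' gg'.
have eq_adj a : a \in J -> adj g b a = adj g' b a.
  by move=> aJ; rewrite /adj gg' //=; apply/existsP; exists a; rewrite aJ eqxx.
rewrite /light_wcherry (_ : wdeg g b = wdeg g' b); last first.
  by apply: eq_bigr => a aJ; rewrite eq_adj.
case: ifP => // _; apply: eq_bigr => a aJ.
by apply: eq_bigr => c /andP[cJ _]; rewrite !eq_adj.
Qed.

End WeightedDegrees.
End Graphs.

Lemma prod_if_two (R : comPzSemiRingType) (T : finType) (J : {set T}) (a b : T)
    (F : T -> R) : a \in J -> b \in J -> b != a ->
  \prod_(c in J) (if (c == a) || (c == b) then F c else 1) = F a * F b.
Proof.
move=> aJ bJ ba; rewrite (bigD1 a) //= (bigD1 b) /= ?bJ // !eqxx orbT.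
by rewrite big1 ?mulr1 // => c /andP[/andP[_ /negPf ->] /negPf ->].
Qed.

Section RandomGraph.
Variables (R : realType) (m : nat) (p : R).
Hypothesis p01 : 0 <= p <= 1.
Implicit Types (g : graph m) (b c : 'I_m) (J : {set 'I_m}).

Definition random_graph : distr R (graph m) :=
  ffun_distr ('I_m * 'I_m)%type (bernoulli p01).

Let p_ge0 : 0 <= p. Proof. by case/andP: p01. Qed.

Section Cherries.
Variables (v : 'I_m -> R) (J : {set 'I_m}) (vmax vsum : R).
Hypothesis v_itv : forall a, 0 <= v a <= vmax.
Hypothesis v_sum : \sum_(a in J) v a <= vsum.

Let v_ge0 a : 0 <= v a. Proof. by case/andP: (v_itv a). Qed.

Lemma Ex_cherry_mgf b a1 a2 (th : R) :
  0 <= th -> th * vmax <= 2^-1 -> th * vsum * p <= 2^-1 ->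
  b \notin J -> a1 \in J -> a2 \in J -> a2 != a1 ->
  Ex random_graph
    (fun g => (adj g b a1 && adj g b a2)%:R * expR (th * wdeg v J g b)) <=
  16 * p ^+ 2.
Proof.
move=> th0 th_max th_sum bJ a1J a2J a12.
have neb a : a \in J -> b != a by move=> aJ; apply: contraNneq bJ => ->.
pose h a (x : bool) : R :=
  (if (a == a1) || (a == a2) then x%:R else 1) * expR (th * v a * x%:R).
rewrite (@eq_Ex _ _ _ _ (fun g => \prod_(a in J) h a (g (edge b a)))); last first.
  move=> g; rewrite big_split /= prod_if_two // -expR_sum; congr (_ * expR _).
    by rewrite /adj !neb //= -natrM mulnb.
  by rewrite mulr_sumr; apply: eq_bigr => a aJ; rewrite /adj neb // mulrA.
rewrite (Ex_prod_coord _ h (in2W (@edge_injr m b))).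
apply: le_trans (_ : _ <= _) _.
  apply: ler_prod => a _; apply/andP; split.
    by apply: Ex_ge0 => x; rewrite mulr_ge0 ?expR_ge0 //; case: ifP.
  case/andP: (v_itv a) => va0 va; apply: bernoulli_marked_mgf; first by rewrite mulr_ge0.
  by apply: le_trans th_max; rewrite ler_wpM2l.
rewrite big_split /= prod_if_two // -expR_sum -expr2 exprMn.
rewrite mulrC mulrCA mulrC ler_wpM2r ?sqr_ge0 // -!mulr_sumr.
have -> : 16 = 4 * 4 :> R by lra.
apply: ler_pM; rewrite ?sqr_ge0 ?expR_ge0 //; last first.
  rewrite -expRM_natl; apply: le_trans (expR1_le4 R); rewrite ler_expR; lra.
apply: le_trans (expR1_le4 R); rewrite ler_expR.
have := ler_wpM2l (mulr_ge0 p_ge0 th0) v_sum; lra.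
Qed.

Lemma Ex_wcherry_mgf b (th : R) :
  0 <= th -> th * vmax <= 2^-1 -> th * vsum * p <= 2^-1 -> b \notin J ->
  Ex random_graph (fun g => wcherry v J g b * expR (th * wdeg v J g b)) <=
  16 * (vsum * p) ^+ 2.
Proof.
move=> th0 th_max th_sum bJ.
rewrite (@eq_Ex _ _ _ _ (fun g => \sum_(a in J) \sum_(c in J | c != a)
   v a * v c * ((adj g b a && adj g b c)%:R * expR (th * wdeg v J g b)))); last first.
  move=> g; rewrite mulr_suml; apply: eq_bigr => a _; rewrite mulr_suml.
  by apply: eq_bigr => c _; rewrite mulrA.
rewrite Ex_sum (@le_trans _ _ (\sum_(a in J) \sum_(c in J) v a * v c * (16 * p ^+ 2))) //.
  apply: ler_sum => a aJ; rewrite Ex_sum big_mkcondr; apply: ler_sum => c cJ.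
  case: ifP => ca; last by rewrite !mulr_ge0 ?sqr_ge0.
  by rewrite ExZ ler_wpM2l ?mulr_ge0 // Ex_cherry_mgf.
under eq_bigr do rewrite -mulr_suml -mulr_sumr.
rewrite -!mulr_suml mulrCA exprMn ler_pM2l // ler_wpM2r ?sqr_ge0 //.
have s0 : 0 <= \sum_(a in J) v a by apply: sumr_ge0.
by rewrite expr2 ler_pM.
Qed.

Variables (D rate : R).
Hypotheses (D_ge0 : 0 <= D) (rate_ge0 : 0 <= rate).
Hypothesis rate_max : rate * D * vmax <= 2^-1.
Hypothesis rate_sum : rate * D * vsum * p <= 2^-1.

Lemma light_wcherry_mgf b : b \notin J ->
  Ex random_graph (fun g => expR (rate * light_wcherry v J D g b)) <=
  expR (rate * (16 * (vsum * p) ^+ 2)).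
Proof.
move=> bJ; apply: le_trans (expR_ge1Dx _).
apply: (@le_trans _ _ (Ex random_graph
   (fun g => 1 + rate * (wcherry v J g b * expR (rate * D * wdeg v J g b))))).
  apply: ler_Ex => g; have q0 := wcherry_ge0 J v_ge0 g b; rewrite /light_wcherry.
  case: ifP => [le_D|_]; last by rewrite mulr0 expR0 lerDl !mulr_ge0 ?expR_ge0.
  apply: le_trans (expR_le1DMexpR _) _; rewrite mulrA lerD2l ler_wpM2l ?mulr_ge0 //.
  rewrite ler_expR -mulrA ler_wpM2l //; apply: le_trans (wcherry_le J v_ge0 g b) _.
  by rewrite expr2 ler_wpM2r ?wdeg_ge0.
by rewrite ExD Ex_cst ExZ lerD2l ler_wpM2l // Ex_wcherry_mgf // mulr_ge0.
Qed.

(* The stars of the vertices outside [J] are edge-disjoint, so their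
   contributions are independent. *)
Lemma light_wcherry_tail (z : R) :
  Pr random_graph (fun g => z <= \sum_(b | b \notin J) light_wcherry v J D g b) <=
  expR (rate * (m%:R * (16 * (vsum * p) ^+ 2) - z)).
Proof.
apply: (@le_trans _ _ (Pr random_graph (fun g =>
    rate * z <= \sum_(b | b \notin J) rate * light_wcherry v J D g b))).
  by apply: ler_Pr => g hz; rewrite -mulr_sumr ler_wpM2l.
apply: le_trans (Pr_chernoff _ _ _) _; under eq_Ex do rewrite expR_sum.
rewrite (Ex_prod_indep _ (G := star J)); last 2 first.
- by move=> b _ g g' gg'; rewrite (light_wcherry_star v D gg').
- by move=> b b' e; exact: star_disjoint.
rewrite mulrBr addrC expRD ler_wpM2l ?expR_ge0 //.
apply: (@le_trans _ _ (\prod_(b | b \notin J) expR (rate * (16 * (vsum * p) ^+ 2)))).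
  apply: ler_prod => b bJ; rewrite light_wcherry_mgf // andbT.
  by apply: Ex_ge0 => g; exact: expR_ge0.
rewrite prodr_const -expRM_natr ler_expR -mulrA ler_wpM2l // mulrC.
apply: ler_wpM2r; first by rewrite mulr_ge0 ?sqr_ge0.
by rewrite ler_nat -[leqRHS]card_ord max_card.
Qed.

End Cherries.

Lemma wdeg_tail (v : 'I_m -> R) J b (z : R) : (forall a, 0 <= v a) ->
  Pr random_graph (fun g => z <= wdeg v J g b) <=
  expR (p * \sum_(a in J) (expR (v a) - 1) - z).
Proof.
move=> v0.
apply: (@le_trans _ _ (Pr random_graph (fun g =>
    z <= \sum_(a | (a \in J) && (a != b)) v a * (g (edge b a))%:R))).
  apply: ler_Pr => g; congr (_ <= _ : Prop).
  rewrite [RHS]big_mkcondr; apply: eq_bigr => a _.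
  by rewrite /adj eq_sym; case: eqP => //=; rewrite mulr0.
apply: le_trans (bernoulli_sum_tail p01 _ _ (in2W (@edge_injr m b))) _.
rewrite ler_expR lerD2r ler_wpM2l // big_mkcondr; apply: ler_sum => a _.
by case: ifP => // _; rewrite subr_ge0 expR_ge1.
Qed.

Lemma deg_tail b (z : R) :
  Pr random_graph (fun g => z <= #|nbr g b|%:R) <= expR (3 * p * m%:R - z).
Proof.
apply: le_trans (_ : Pr _ (fun g => z <= wdeg (fun=> 1) [set: 'I_m] g b) <= _).
  apply: ler_Pr => g; congr (_ <= _ : Prop); rewrite /nbr -sum1_card natr_sum big_mkcond.
  by apply: eq_big => a; rewrite inE // mul1r; case: adj.
apply: le_trans (wdeg_tail _ _ _ (fun=> ler01)) _.
rewrite ler_expR lerD2r sumr_const cardsT card_ord -[_ *+ m]mulr_natr mulrA.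
rewrite ler_wpM2r // mulrC ler_wpM2r //; have := expR1_le4 R; lra.
Qed.

Lemma codeg_tail b c (z : R) : b != c ->
  Pr random_graph (fun g => z <= (codeg g b c)%:R) <= expR (3 * p ^+ 2 * m%:R - z).
Proof.
move=> bc; pose other a := (a != b) && (a != c).
pose both g a := g (edge b a) && g (edge c a).
have edge_neq a a' : other a -> edge b a != edge c a'.
  case/andP=> ab ac; apply/eqP => /edge_eq[[eq_bc _]|[_ eq_ac]].
    by rewrite eq_bc eqxx in bc.
  by rewrite eq_ac eqxx in ac.
have codegE g : (codeg g b c)%:R <= \sum_(a | other a) (both g a)%:R :> R.
  rewrite /codeg -sum1_card natr_sum [leRHS]big_mkcond [leLHS]big_mkcond /=.
  apply: ler_sum => a _; rewrite !inE /adj eq_sym [c == a]eq_sym /other /both.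
  by case: (a == b); case: (a == c) => //=; case: (g _); case: (g _).
apply: le_trans (_ : Pr _ (fun g => z <= \sum_(a | other a) (both g a)%:R) <= _).
  by apply: ler_Pr => g /le_trans; exact.
apply: le_trans (Pr_chernoff _ _ _) _; under eq_Ex do rewrite expR_sum.
rewrite (Ex_prod_indep _ (G := fun a => pred2 (edge b a) (edge c a))); last 2 first.
- by move=> a _ g g' gg'; rewrite /both !gg' //= eqxx ?orbT.
- move=> a a' e oa oa' /orP[] /eqP -> /orP[] /eqP; try exact: edge_injr.
    by move/eqP; rewrite (negPf (edge_neq _ _ oa)).
  by move/esym/eqP; rewrite (negPf (edge_neq _ _ oa')).
rewrite addrC expRD ler_wpM2l ?expR_ge0 //.
apply: (@le_trans _ _ (\prod_(a | other a) expR (3 * p ^+ 2))); last first.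
  rewrite prodr_const -expRM_natr ler_expR ler_wpM2l ?mulr_ge0 ?sqr_ge0 //.
  by rewrite ler_nat -[leqRHS]card_ord max_card.
apply: ler_prod => a oa; rewrite Ex_ge0 /= => [|g]; last exact: expR_ge0.
by apply: bernoulli_pair_mgf; exact: edge_neq.
Qed.

Lemma edges_in_tail J (z : R) :
  Pr random_graph (fun g => z <= #|edges_in g J|%:R) <=
  expR (3 / 2 * p * #|J|%:R ^+ 2 - z).
Proof.
apply: le_trans (_ : Pr _ (fun g => 1 * z <= 1 * #|edges_in g J|%:R) <= _).
  by apply: ler_Pr => g; rewrite !mul1r.
apply: le_trans (bernoulli_card_tail p01 (pairs J) 1 z) _.
rewrite mul1r ler_expR lerD2r card_pairs.
have mean_le : p * (expR 1 - 1) <= p * 3.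
  by rewrite ler_wpM2l //; have := expR1_le4 R; lra.
have pairs_ge0 : 0 <= #|J|%:R ^+ 2 - #|J|%:R :> R.
  rewrite subr_ge0 -natrX ler_nat; case: #|J| => // j.
  by rewrite -{1}[j.+1]expn1 leq_pexp2l.
have := ler_wpM2r pairs_ge0 mean_le; have := mulr_ge0 p_ge0 (ler0n R #|J|); lra.
Qed.

End RandomGraph.

(** * Almost disjoint families of sets *)

Lemma card_sum_mem (T : finType) (B : {set T}) : #|B| = (\sum_x (x \in B))%N.
Proof. by rewrite -sum1_card big_mkcond; apply: eq_bigr => x _; case: (x \in B). Qed.

Lemma bonferroni_le (I T : finType) (F : I -> {set T}) (K : {set I}) :
  (\sum_(i in K) #|F i| <= #|\bigcup_(i in K) F i| +
     \sum_(i in K) \sum_(j in K | j != i) #|F i :&: F j|)%N.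
Proof.
rewrite card_sum_mem; under eq_bigr do rewrite card_sum_mem.
rewrite exchange_big /=.
under [X in (_ <= _ + X)%N]eq_bigr => i _.
  under eq_bigr do rewrite card_sum_mem.
  rewrite exchange_big /=. over.
rewrite [X in (_ <= _ + X)%N]exchange_big /= -big_split; apply: leq_sum => x _.
case: (boolP (x \in \bigcup_(i in K) F i)) => [/bigcupP[i iK xi]|x_out]; last first.
  rewrite big1 // => i iK; apply/eqP; rewrite eqb0; apply: contra x_out => xi.
  by apply/bigcupP; exists i.
rewrite (bigD1 i) //= xi leq_add2l (bigD1 i iK) /=; apply: leq_trans (leq_addr _ _).
by apply: leq_sum => j _; rewrite inE xi.
Qed.

Section AlmostDisjoint.
Variables (I T : finType) (F : I -> {set T}) (U : {set T}) (q : nat).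
Hypothesis F_sub : forall i, F i \subset U.
Hypothesis F_overlap : forall i j, i != j -> (#|F i :&: F j| <= q)%N.

Lemma sum_card_overlap (K : {set I}) :
  (\sum_(i in K) #|F i| <= #|\bigcup_(i in K) F i| + #|K| ^ 2 * q)%N.
Proof.
apply: leq_trans (bonferroni_le F K) _; rewrite leq_add2l.
apply: (@leq_trans (\sum_(i in K) \sum_(j in K) q)).
  apply: leq_sum => i iK; rewrite big_mkcondr; apply: leq_sum => j jK.
  by case: ifP => // ji; rewrite F_overlap // eq_sym.
by rewrite !sum_nat_const -mulnn mulnA.
Qed.

Lemma sum_card_overlap_le (K : {set I}) t : (#|K| <= t)%N ->
  (\sum_(i in K) #|F i| <= #|U| + t ^ 2 * q)%N.
Proof.
move=> Kt; apply: leq_trans (sum_card_overlap K) _.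
rewrite leq_add ?leq_mul2r ?leq_sqr ?Kt ?orbT // subset_leq_card //.
by apply/bigcupsP.
Qed.

Lemma card_large_members (R : realFieldType) (D : R) t :
  (0 < #|U|)%N -> #|U|%:R + (t ^ 2 * q)%:R <= t%:R * D ->
  (#|[set i | (D < #|F i|%:R)%R]| <= t)%N.
Proof.
move=> U0 tD; set K := [set i | _]; rewrite leqNgt; apply/negP => lt_tK.
pose s := take t (enum K); pose K' := [set i in s].
have cardK' : #|K'| = t.
  rewrite cardsE (card_uniqP _) ?take_uniq ?enum_uniq // size_takel //.
  by rewrite -cardE ltnW.
have t0 : (0 < t)%N.
  rewrite lt0n; apply: contraTneq tD => ->.
  by rewrite mul0r mul0n addr0 lern0 -lt0n.
have [i0 i0K'] : exists i, i \in K' by apply/card_gt0P; rewrite cardK'.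
have large i : i \in K' -> D < #|F i|%:R.
  by rewrite inE => /mem_take; rewrite mem_enum inE.
suff : t%:R * D < (#|U| + t ^ 2 * q)%:R by rewrite natrD ltNge tD.
apply: (@lt_le_trans _ _ (\sum_(i in K') #|F i|%:R)).
  rewrite -cardK' mulr_natl -sumr_const; apply: ltr_sum => //.
  by apply/hasP; exists i0; rewrite ?mem_index_enum.
by rewrite -natr_sum ler_nat sum_card_overlap_le ?cardK'.
Qed.

End AlmostDisjoint.

Lemma binE_card_sets (T : finType) k : 'C(#|T|, k) = #|[pred B : {set T} | #|B| == k]|.
Proof. by rewrite -card_draws; apply: eq_card => B; rewrite !inE. Qed.

Lemma small_set_enum (T : finType) (B : {set T}) d : (#|B| <= d)%N ->
  exists f : {ffun 'I_d -> option T}, forall x, (x \in B) = [exists i, f i == Some x].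
Proof.
move=> Bd; exists [ffun i : 'I_d => onth (enum B) i] => x.
rewrite -mem_enum; apply/onthP/existsP => [[i Bi]|[i]]; last first.
  by rewrite ffunE => /eqP Bi; exists i.
have i_lt : (i < d)%N by apply: leq_trans Bd; rewrite cardE -onthTE Bi.
by exists (Ordinal i_lt); rewrite ffunE Bi.
Qed.

Lemma card_small_sets (T : finType) d :
  (#|[set B : {set T} | #|B| <= d]| <= #|T|.+1 ^ d)%N.
Proof.
pose im (f : {ffun 'I_d -> option T}) := [set x | [exists i, f i == Some x]].
have -> : (#|T|.+1 ^ d = #|{ffun 'I_d -> option T}|)%N.
  by rewrite card_ffun card_option card_ord.
apply: leq_trans (leq_imset_card im predT); apply: subset_leq_card.
apply/subsetP => B; rewrite inE => /small_set_enum[f Bf]; apply/imsetP.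
by exists f => //; apply/setP => x; rewrite inE.
Qed.

(** * Labelled neighbourhoods *)

Definition fiber (X : finType) (Y : eqType) (J : {set X}) (lab : X -> Y) y :=
  [set a in J | lab a == y].

Lemma card_fiber_id (T : finType) (J : {set T}) (b : T) : (#|fiber J id b| <= 1)%N.
Proof.
apply: leq_trans (_ : #|[set b]| <= 1)%N; last by rewrite cards1.
by apply: subset_leq_card; apply/subsetP => a; rewrite !inE => /andP[].
Qed.

Section LabelledNeighborhoods.
Variables (m : nat) (X : finType).
Implicit Types (h : graph m) (J : {set X}) (lab : X -> 'I_m) (b : 'I_m).

Definition lnbr J lab h b := [set a in J | adj h b (lab a)].
Definition lcherries J lab h b : {set X * X} :=
  [set e in setX J J | [&& lab e.1 != lab e.2, adj h b (lab e.1) & adj h b (lab e.2)]].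

Lemma lnbr_overlap J lab h r S b c :
  (codeg h b c <= r)%N -> (forall b', #|fiber J lab b'| <= S)%N ->
  (#|lnbr J lab h b :&: lnbr J lab h c| <= r * S)%N.
Proof.
move=> codeg_r fiberS.
apply: (@leq_trans #|\bigcup_(x in nbr h b :&: nbr h c) fiber J lab x|).
  apply: subset_leq_card; apply/subsetP => a; rewrite !inE.
  case/andP=> /andP[aJ ab] /andP[_ ac].
  by apply/bigcupP; exists (lab a); rewrite !inE ?ab ?ac ?aJ ?eqxx.
apply: leq_trans (card_big_setU _ _ _) _.
apply: (@leq_trans (\sum_(x in nbr h b :&: nbr h c) S)); first exact: leq_sum.
by rewrite sum_nat_const leq_mul2r codeg_r orbT.
Qed.

Section FiberWeights.
Variables (R : realFieldType) (J : {set X}) (lab : X -> 'I_m) (J' : {set 'I_m}).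
Hypothesis lab_J' : forall a, a \in J -> lab a \in J'.

Definition fiber_weight b : R := #|fiber J lab b|%:R.

Lemma fiber_weight_ge0 b : 0 <= fiber_weight b. Proof. exact: ler0n. Qed.

Lemma sum_fiber_weight (F : 'I_m -> R) :
  \sum_(b in J') fiber_weight b * F b = \sum_(a in J) F (lab a).
Proof.
rewrite [RHS](partition_big lab (mem J')) //=; apply: eq_bigr => b _.
rewrite (eq_bigr (fun=> F b)) => [|a /andP[_ /eqP -> //]].
by rewrite sumr_const mulr_natl /fiber cardsE.
Qed.

Lemma sum_fiber_weight1 : \sum_(b in J') fiber_weight b = #|J|%:R.
Proof.
rewrite -sumr_const -(sum_fiber_weight (fun=> 1)).
by apply: eq_bigr => b _; rewrite mulr1.
Qed.

Lemma wdeg_fiber h b : wdeg fiber_weight J' h b = #|lnbr J lab h b|%:R.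
Proof.
by rewrite /wdeg (sum_fiber_weight (fun c => (adj h b c)%:R)) -natr_card_set.
Qed.

Lemma wcherry_fiber h b : wcherry fiber_weight J' h b = #|lcherries J lab h b|%:R.
Proof.
transitivity (\sum_(b1 in J') fiber_weight b1 * \sum_(b2 in J') fiber_weight b2 *
    [&& b1 != b2, adj h b b1 & adj h b b2]%:R).
  apply: eq_bigr => b1 _; rewrite mulr_sumr big_mkcondr; apply: eq_bigr => b2 _.
  by rewrite mulrA eq_sym; case: eqP => //= _; rewrite mulr0.
rewrite sum_fiber_weight; under eq_bigr do rewrite sum_fiber_weight.
rewrite /lcherries (natr_card_set _ (mem (setX J J))) pair_big /=.
by apply: eq_bigl => -[a c]; rewrite in_setX.
Qed.

Lemma light_wcherry_fiber (D : R) h b : #|lnbr J lab h b|%:R <= D ->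
  light_wcherry fiber_weight J' D h b = #|lcherries J lab h b|%:R.
Proof. by rewrite /light_wcherry wdeg_fiber => ->; exact: wcherry_fiber. Qed.

Definition outer_light_cherries (D : R) h : R :=
  \sum_(b | b \notin J') light_wcherry fiber_weight J' D h b.

End FiberWeights.

End LabelledNeighborhoods.

Lemma lnbr_tail (R : realType) (m : nat) (p : R) (p01 : 0 <= p <= 1) (V : finType)
    (J : {set V}) (lab : V -> 'I_m) (S : nat) (b : 'I_m) (s x : R) :
  (forall b', #|fiber J lab b'| <= S)%N -> 0 < s -> s * S%:R <= 2^-1 ->
  Pr (random_graph m p01) (fun g => x <= #|lnbr J lab g b|%:R) <=
  expR (s * (p * #|J|%:R * (1 + 2 * (s * S%:R)) - x)).
Proof.
move=> fiberS s0 sS; pose v a := s * fiber_weight R J lab a.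
have lab_setT a : a \in J -> lab a \in [set: 'I_m] by rewrite inE.
have v0 a : 0 <= v a by rewrite mulr_ge0 ?fiber_weight_ge0 // ltW.
apply: le_trans (_ : Pr _ (fun g => s * x <= wdeg v [set: 'I_m] g b) <= _).
  apply: ler_Pr => g xg; rewrite /wdeg; under eq_bigr do rewrite -mulrA.
  by rewrite -mulr_sumr -/(wdeg _ _ _ _) (wdeg_fiber _ lab_setT) ler_pM2l.
apply: le_trans (wdeg_tail p01 _ _ _ v0) _; rewrite ler_expR mulrBr lerD2r.
have p0 : 0 <= p by case/andP: p01.
apply: (@le_trans _ _ (p * \sum_(a in [set: 'I_m])
    fiber_weight R J lab a * (s * (1 + 2 * (s * S%:R))))).
  rewrite ler_wpM2l //; apply: ler_sum => a _.
  have v_S : v a <= s * S%:R by rewrite ler_pM2l // ler_nat.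
  have := expR_le_quadratic (v0 a) (le_trans v_S sS).
  by have := ler_wpM2l (v0 a) v_S; rewrite /v expr2; lra.
by rewrite -mulr_suml (sum_fiber_weight1 _ lab_setT); lra.
Qed.

(** * Closed pairs *)

Section ClosedPairs.
Variable m : nat.
Implicit Types (g h : graph m) (P : pred 'I_m) (J : {set 'I_m}).
Implicit Types (lab : 'I_m -> 'I_m) (e : 'I_m * 'I_m).

Definition common_nbr P g (a b : 'I_m) := [exists c, [&& P c, adj g c a & adj g c b]].

Definition closed_via J lab h P :=
  [set e in pairs J | common_nbr P h (lab e.1) (lab e.2)].

Definition closed_pair lab g h e :=
  common_nbr predT h (lab e.1) (lab e.2) || common_nbr (fun c => e.2 < c)%N g e.1 e.2.

Definition lightly_closed (R : realFieldType) J lab (th : R) g h e :=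
  (e \in pairs J) &&
  [|| lab e.1 == lab e.2,
      common_nbr (fun b => #|lnbr J lab h b|%:R <= th) h (lab e.1) (lab e.2)
    | common_nbr (fun c => e.2 < c)%N g e.1 e.2].

Definition covered J lab t (A : {ffun 'I_t -> {set 'I_m}}) :=
  [set e in pairs J | [exists i, (lab e.1 \in A i) && (lab e.2 \in A i)]].

(* Whether [e] is lightly closed is decided by the pairs with a larger endpoint:
   this is why [closed_pair] uses only common neighbours above both ends. *)
Lemma lightly_closed_predictable (R : realFieldType) J lab (th : R) h e :
  depends_on (fun a : 'I_m * 'I_m => (e.2 : nat) < a.2)%N
    (fun g => lightly_closed J lab th g h e).
Proof.
move=> g g' gg'; rewrite /lightly_closed; congr (_ && (_ || (_ || _))).
apply: eq_existsb => c; case: ltnP => //= ec.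
by rewrite /adj !gg' // edge_snd leq_max ec.
Qed.

Section Counting.
Variables (R : realFieldType) (J J' : {set 'I_m}) (lab : 'I_m -> 'I_m) (h : graph m).
Hypothesis lab_J' : forall a, a \in J -> lab a \in J'.

Lemma card_same_label S : (forall b, #|fiber J lab b| <= S)%N ->
  (#|[set e in pairs J | lab e.1 == lab e.2]| <= #|J| * S)%N.
Proof.
move=> fiberS.
apply: (@leq_trans #|\bigcup_(a in J) setX [set a] (fiber J lab (lab a))|).
  apply: subset_leq_card; apply/subsetP => -[a c]; rewrite !inE /=.
  case/andP=> /and3P[aJ cJ _] /eqP ac; apply/bigcupP; exists a => //.
  by rewrite !inE /= cJ ac !eqxx.
apply: leq_trans (card_big_setU _ _ _) _.
by rewrite -sum_nat_const; apply: leq_sum => a _; rewrite cardsX cards1 mul1n.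
Qed.

Lemma card_light_common_nbr P (D : R) : (forall b, P b -> #|lnbr J lab h b|%:R <= D) ->
  #|[set e in closed_via J lab h P | lab e.1 != lab e.2]|%:R <=
  \sum_b light_wcherry (fiber_weight R J lab) J' D h b.
Proof.
move=> lightP.
apply: (@le_trans _ _ (\sum_(b | P b) #|lcherries J lab h b|%:R)).
  rewrite -natr_sum ler_nat; apply: leq_trans (card_big_setU _ _ _).
  apply: subset_leq_card; apply/subsetP => e; rewrite !inE.
  case/andP=> /andP[/and3P[aJ cJ _] /existsP[b /and3P[Pb b1 b2]]] ne.
  by apply/bigcupP; exists b; rewrite // !inE aJ cJ ne b1 b2.
rewrite big_mkcond; apply: ler_sum => b _; case: ifP => [/lightP light_b|_].
  by rewrite light_wcherry_fiber.
rewrite /light_wcherry; case: ifP => // _; apply: wcherry_ge0.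
exact: fiber_weight_ge0.
Qed.

Lemma sum_light_wcherry_fiber_le (S : nat) (D z y : R) :
  0 <= D -> (forall b, #|fiber J lab b| <= S)%N ->
  outer_light_cherries J lab J' D h <= z ->
  #|edges_in h J'|%:R <= y ->
  \sum_b light_wcherry (fiber_weight R J lab) J' D h b <= z + 2 * D * S%:R * y.
Proof.
move=> D0 fiberS outer_z edges_y; rewrite (bigID (mem J')) /= addrC lerD //.
have weightS b : fiber_weight R J lab b <= S%:R by rewrite ler_nat.
have := sum_light_wcherry_le J' (fiber_weight_ge0 R J lab) h D0 weightS.
by move/le_trans; apply; rewrite ler_wpM2l ?mulr_ge0.
Qed.

Lemma card_heavy_common_nbr (H : {set 'I_m}) P (th c : R) : 0 <= th ->
  (forall b, P b -> #|lnbr J lab h b|%:R <= th) ->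
  (\sum_(b in H) #|lnbr J lab h b|)%:R <= c ->
  #|closed_via J lab h [pred b in H | P b]|%:R <= th * c.
Proof.
move=> th0 Pth sumH.
apply: (@le_trans _ _ (\sum_(b in H | P b) #|lnbr J lab h b|%:R * #|lnbr J lab h b|%:R)).
  under eq_bigr do rewrite -natrM -cardsX.
  rewrite -natr_sum ler_nat; apply: leq_trans (card_big_setU _ _ _).
  apply: subset_leq_card; apply/subsetP => e; rewrite !inE.
  case/andP=> /and3P[aJ cJ _] /existsP[b /and3P[/= bHP b1 b2]].
  by apply/bigcupP; exists b; rewrite // !inE aJ cJ b1 b2.
apply: le_trans (ler_wpM2l th0 sumH); rewrite natr_sum mulr_sumr big_mkcondr.
apply: ler_sum => b bH; case: ifP => [/Pth Pb|_]; first by rewrite ler_wpM2r.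
by rewrite mulr_ge0.
Qed.

End Counting.

Section HeavyFamily.
Variables (R : realFieldType) (J J' : {set 'I_m}) (lab : 'I_m -> 'I_m) (h : graph m).
Variables (k S d r : nat).
Hypothesis lab_J' : forall a, a \in J -> lab a \in J'.
Hypotheses (J_gt0 : (0 < #|J|)%N) (J_le : (#|J| <= k)%N).
Hypothesis fiber_le : forall b, (#|fiber J lab b| <= S)%N.
Hypothesis deg_le : forall b, (#|nbr h b| <= d)%N.
Hypothesis codeg_le : forall b c, b != c -> (codeg h b c <= r)%N.

Let lnbr_sub b : lnbr J lab h b \subset J.
Proof. by apply/subsetP => a; rewrite inE => /andP[]. Qed.

Let overlap_le b c : b != c -> (#|lnbr J lab h b :&: lnbr J lab h c| <= r * S)%N.
Proof. by move=> /codeg_le codeg_r; apply: lnbr_overlap. Qed.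

Lemma card_large_lnbr (D : R) t : k%:R + (t ^ 2 * (r * S))%:R <= t%:R * D ->
  (#|[set b | (D < #|lnbr J lab h b|%:R)%R]| <= t)%N.
Proof.
move=> tD; apply: (card_large_members lnbr_sub overlap_le) => //.
by apply: le_trans tD; rewrite lerD2r ler_nat.
Qed.

Lemma sum_lnbr_le (T : {set 'I_m}) t : (#|T| <= t)%N ->
  (\sum_(b in T) #|lnbr J lab h b| <= k + t ^ 2 * (r * S))%N.
Proof.
move=> Tt; apply: leq_trans (sum_card_overlap_le lnbr_sub overlap_le Tt) _.
by rewrite leq_add2r.
Qed.

Lemma card_own_common_nbr g (y z : R) : (forall b, #|nbr g b| <= d)%N ->
  outer_light_cherries J id J d%:R g <= z ->
  #|edges_in g J|%:R <= y ->
  #|[set e in closed_via J id g predT | e.1 != e.2]|%:R <=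
  z + 2 * d%:R * y.
Proof.
move=> gdeg zg yg.
have gdeg_light b : predT b -> #|lnbr J id g b|%:R <= d%:R :> R.
  move=> _; rewrite ler_nat; apply: leq_trans (gdeg b); apply: subset_leq_card.
  by apply/subsetP => a; rewrite !inE => /andP[].
apply: le_trans (card_light_common_nbr (J' := J) _ gdeg_light) _ => //.
rewrite -[2 * d%:R]mulr1; apply: (sum_light_wcherry_fiber_le (S := 1)) => // b.
exact: card_fiber_id.
Qed.

Lemma card_lightly_closed g t (D th y z : R) :
  (forall b, #|nbr g b| <= d)%N -> 0 <= D -> D <= th ->
  k%:R + (t ^ 2 * (r * S))%:R <= t%:R * D ->
  outer_light_cherries J lab J' D h <= z ->
  outer_light_cherries J id J d%:R g <= z ->
  #|edges_in h J'|%:R <= y -> #|edges_in g J|%:R <= y ->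
  #|[set e | lightly_closed J lab th g h e]|%:R <=
  (k * S)%:R + (z + 2 * D * S%:R * y) + th * (k + t ^ 2 * (r * S))%:R +
  (z + 2 * d%:R * y).
Proof.
move=> gdeg D0 Dth tD zh zg yh yg.
pose light b := #|lnbr J lab h b|%:R <= D.
pose heavy := [set b | (D < #|lnbr J lab h b|%:R)%R].
pose same := [set e in pairs J | lab e.1 == lab e.2].
pose via_light := [set e in closed_via J lab h light | lab e.1 != lab e.2].
pose via_heavy := closed_via J lab h [pred b in heavy | #|lnbr J lab h b|%:R <= th].
pose via_own := [set e in closed_via J id g predT | e.1 != e.2].
have split_closed : [set e | lightly_closed J lab th g h e] \subset
    same :|: via_light :|: via_heavy :|: via_own.
  apply/subsetP => e; rewrite !in_setU /lightly_closed !in_set.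
  case/andP=> eJ; rewrite eJ /=; case: (lab e.1 =P lab e.2) => //= _.
  rewrite andbT => /orP[] /existsP[b /and3P[Pb b1 b2]]; last first.
    have ne : e.1 != e.2 by case/and3P: eJ => _ _; rewrite -val_eqE => /ltn_eqF ->.
    by rewrite ne andbT orbC; apply/orP; left; apply/existsP; exists b; rewrite b1 b2.
  case: (lerP #|lnbr J lab h b|%:R D) => hD.
    by apply/orP; left; apply/orP; left; apply/existsP; exists b; rewrite /light hD b1 b2.
  apply/orP; left; apply/orP; right; apply/existsP; exists b.
  by rewrite b1 b2 /= inE hD Pb.
have same_le : #|same|%:R <= (k * S)%:R :> R.
  rewrite ler_nat; apply: leq_trans (card_same_label fiber_le) _.
  by rewrite leq_mul2r J_le orbT.
have light_le : #|via_light|%:R <= z + 2 * D * S%:R * y.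
  apply: le_trans (card_light_common_nbr lab_J' (fun b => id)) _.
  exact: sum_light_wcherry_fiber_le.
have heavy_le : #|via_heavy|%:R <= th * (k + t ^ 2 * (r * S))%:R.
  apply: card_heavy_common_nbr => //; first exact: le_trans Dth.
  by rewrite ler_nat; apply: sum_lnbr_le; exact: card_large_lnbr.
have own_le : #|via_own|%:R <= z + 2 * d%:R * y by exact: card_own_common_nbr.
apply: (@le_trans _ _ (#|same| + #|via_light| + #|via_heavy| + #|via_own|)%:R).
  rewrite ler_nat; apply: leq_trans (subset_leq_card split_closed) _.
  do 2![apply: leq_trans (leq_card_setU _ _) _; rewrite leq_add2r].
  exact: leq_card_setU.
by move: same_le light_le heavy_le own_le; rewrite !natrD; lra.
Qed.

Definition nbr_family t (f : {ffun 'I_t -> option 'I_m}) : {ffun 'I_t -> {set 'I_m}} :=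
  [ffun i => oapp (nbr h) set0 (f i)].

Lemma card_nbr_family t (f : {ffun 'I_t -> option 'I_m}) i : (#|nbr_family f i| <= d)%N.
Proof. by rewrite ffunE; case: (f i) => [b|] /=; rewrite ?deg_le ?cards0. Qed.

Lemma covered_nbr_family t (f : {ffun 'I_t -> option 'I_m}) (T : {set 'I_m}) :
  (forall b, (b \in T) = [exists i, f i == Some b]) ->
  covered J lab (nbr_family f) =
  closed_via J lab h (mem T).
Proof.
move=> Tf; apply/setP => e; rewrite !in_set; congr (_ && _).
apply/existsP/existsP => [[i]|[b /and3P[/=]]].
  rewrite ffunE; case fi: (f i) => [b|]; rewrite /= !inE // => /andP[b1 b2].
  exists b; rewrite /= b1 b2 Tf !andbT.
  by apply/existsP; exists i; rewrite fi.
rewrite Tf => /existsP[i /eqP fi] b1 b2; exists i.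
by rewrite ffunE fi /= !inE b1 b2.
Qed.

Lemma card_common_nbr_le (x : R) (T : {set 'I_m}) :
  (forall b, #|lnbr J lab h b|%:R <= x) ->
  #|closed_via J lab h (mem T)|%:R <=
  x / 2 * (\sum_(b in T) #|lnbr J lab h b|)%:R.
Proof.
move=> lnbr_x; apply: (@le_trans _ _ (\sum_(b in T) #|pairs (lnbr J lab h b)|%:R)).
  rewrite -natr_sum ler_nat; apply: leq_trans (card_big_setU _ _ _).
  apply: subset_leq_card; apply/subsetP => e; rewrite !inE.
  case/andP=> /and3P[aJ cJ ac] /existsP[b /and3P[/= bT b1 b2]].
  by apply/bigcupP; exists b; rewrite // !inE aJ cJ ac b1 b2.
rewrite natr_sum mulr_sumr; apply: ler_sum => b _; rewrite card_pairs expr2.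
have := ler_wpM2r (ler0n R #|lnbr J lab h b|) (lnbr_x b).
have := ler0n R #|lnbr J lab h b|; lra.
Qed.

Hypothesis J_cover : forall N : {set 'I_m},
  (#|[set a in J | lab a \in N]| + #|J'| <= k + #|N|)%N.

Lemma sum_lnbr_card_labels (T : {set 'I_m}) t : (#|T| <= t)%N ->
  (\sum_(b in T) #|lnbr J lab h b| + #|J'| <= k + t * d + t ^ 2 * (r * S))%N.
Proof.
move=> Tt; pose N := \bigcup_(b in T) nbr h b.
have unionE : \bigcup_(b in T) lnbr J lab h b = [set a in J | lab a \in N].
  apply/setP => a; rewrite inE; apply/bigcupP/andP => [[b bT]|[aJ /bigcupP[b bT]]].
    by rewrite inE => /andP[aJ hb]; split=> //; apply/bigcupP; exists b; rewrite // inE.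
  by rewrite inE => hb; exists b; rewrite // inE aJ.
have N_le : (#|N| <= t * d)%N.
  apply: leq_trans (card_big_setU _ _ _) _.
  apply: (@leq_trans (\sum_(b in T) d)); first exact: leq_sum.
  by rewrite sum_nat_const leq_mul2r Tt orbT.
have overlaps := sum_card_overlap overlap_le T; rewrite unionE in overlaps.
apply: leq_trans (leq_add overlaps (leqnn _)) _; rewrite addnAC.
rewrite leq_add ?leq_mul2r ?leq_sqr ?Tt ?orbT //.
by apply: leq_trans (J_cover N) _; rewrite leq_add2l.
Qed.

Lemma heavy_family t (th x : R) :
  k%:R + (t ^ 2 * (r * S))%:R <= t%:R * th ->
  0 <= x -> (forall b, #|lnbr J lab h b|%:R <= x) ->
  exists A : {ffun 'I_t -> {set 'I_m}},
  [/\ forall i, (#|A i| <= d)%N,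
      #|covered J lab A|%:R <=
        x / 2 * (k%:R - #|J'|%:R + (t * d)%:R + (t ^ 2 * (r * S))%:R)
    & forall g e, e \in pairs J -> closed_pair lab g h e ->
        lightly_closed J lab th g h e || (e \in covered J lab A)].
Proof.
move=> t_th x0 lnbr_x; have heavy_t := card_large_lnbr t_th.
set T := [set b | _] in heavy_t; have [f Tf] := small_set_enum heavy_t.
exists (nbr_family f); rewrite (covered_nbr_family Tf); split.
- exact: card_nbr_family.
- apply: le_trans (card_common_nbr_le T lnbr_x) _; rewrite ler_wpM2l ?divr_ge0 //.
  have := sum_lnbr_card_labels heavy_t; rewrite -(ler_nat R) !natrD; lra.
move=> g e; rewrite /lightly_closed !in_set => -> /=.
case/orP=> [/existsP[b /and3P[_ b1 b2]]|->]; last by rewrite !orbT.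
case: (lerP #|lnbr J lab h b|%:R th) => hb.
  apply/orP; left; apply/orP; right; apply/orP; left.
  by apply/existsP; exists b; rewrite hb b1 b2.
by apply/orP; right; apply/existsP; exists b; rewrite /= inE hb b1 b2.
Qed.

End HeavyFamily.
End ClosedPairs.

Section FewUncovered.
Variables (R : realType) (m : nat) (p : R).
Hypothesis p01 : 0 <= p <= 1.
Variables (J : {set 'I_m}) (lab : 'I_m -> 'I_m) (t d : nat) (cap z rate : R).
Hypothesis rate_ge0 : 0 <= rate.

Definition uncovered_edges (A : {ffun 'I_t -> {set 'I_m}}) (g : graph m) :=
  [set e in pairs J :\: covered J lab A | g e].

(* Quantifying over all families makes this event depend on [g] alone, hence
   independent of the other colour. *)
Definition few_uncovered (g : graph m) :=
  [exists A : {ffun 'I_t -> {set 'I_m}},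
    [&& [forall i, #|A i| <= d]%N, #|covered J lab A|%:R <= cap
      & #|uncovered_edges A g|%:R <= z]].

Lemma uncovered_edges_tail (A : {ffun 'I_t -> {set 'I_m}}) :
  #|covered J lab A|%:R <= cap ->
  Pr (random_graph m p01) (fun g => #|uncovered_edges A g|%:R <= z) <=
  expR (rate * z - p * (1 - expR (- rate)) * ((#|J|%:R ^+ 2 - #|J|%:R) / 2 - cap)).
Proof.
move=> cov_cap; apply: le_trans (_ : Pr _ (fun g =>
    - rate * z <= - rate * #|uncovered_edges A g|%:R) <= _).
  by apply: ler_Pr => g hg; rewrite !mulNr lerN2 ler_wpM2l.
apply: le_trans (bernoulli_card_tail p01 _ _ _) _; rewrite ler_expR.
have rate_factor_ge0 : 0 <= p * (1 - expR (- rate)).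
  by case/andP: p01 => p0 _; rewrite mulr_ge0 // subr_ge0 expR_le1 oppr_le0.
have uncovered_ge :
    (#|J|%:R ^+ 2 - #|J|%:R) / 2 - cap <= #|pairs J :\: covered J lab A|%:R.
  have : (#|pairs J| <= #|pairs J :\: covered J lab A| + #|covered J lab A|)%N.
    rewrite -(cardsID (covered J lab A) (pairs J)) addnC leq_add2l.
    by rewrite subset_leq_card // subsetIr.
  rewrite -card_pairs -(ler_nat R) natrD; lra.
have := ler_wpM2l rate_factor_ge0 uncovered_ge; lra.
Qed.

Lemma card_small_families :
  (#|[set A : {ffun 'I_t -> {set 'I_m}} | [forall i, #|A i| <= d]]| <= (m.+1 ^ d) ^ t)%N.
Proof.
pose small := [set B : {set 'I_m} | #|B| <= d]%N.
apply: (@leq_trans #|ffun_on (mem small) : {pred {ffun 'I_t -> {set 'I_m}}}|).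
  apply: subset_leq_card; apply/subsetP => A; rewrite inE => /forallP A_small.
  by apply/ffun_onP => i; rewrite inE.
rewrite card_ffun_on card_ord; case: (posnP t) => [->|t_gt0]; first by rewrite !expn0.
have := card_small_sets 'I_m d; rewrite card_ord -/small => small_le.
by rewrite leq_exp2r.
Qed.

Lemma few_uncovered_tail :
  Pr (random_graph m p01) few_uncovered <=
  ((m.+1 ^ d) ^ t)%:R *
  expR (rate * z - p * (1 - expR (- rate)) * ((#|J|%:R ^+ 2 - #|J|%:R) / 2 - cap)).
Proof.
pose good (A : {ffun 'I_t -> {set 'I_m}}) :=
  [forall i, #|A i| <= d]%N && (#|covered J lab A|%:R <= cap).
apply: (@le_trans _ _ (\sum_(A | good A)
    Pr (random_graph m p01) (fun g => #|uncovered_edges A g|%:R <= z))).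
  apply: Pr_exists_le => g /existsP[A /and3P[smallA covA few]].
  by exists A; rewrite /good ?smallA.
set C := expR _; apply: (@le_trans _ _ (\sum_(A | good A) C)).
  by apply: ler_sum => A /andP[_]; exact: uncovered_edges_tail.
rewrite sumr_const -[C *+ _]mulr_natl ler_wpM2r ?expR_ge0 // ler_nat.
apply: leq_trans card_small_families; apply: subset_leq_card.
by apply/subsetP => A /andP[smallA _]; rewrite inE.
Qed.

End FewUncovered.

(** * The two-bite graph *)

Section TwoBite.
Variables (V : finType) (m : nat).
Implicit Types (g h : graph m) (pe pc : V -> 'I_m) (u v w : V) (I : {set V}).

(* The edge [uv] has the colour of [g], whose projection is [pe]; the other
   colour has the graph [h] and the projection [pc]. *)
Definition kept pe pc g h u v :=
  [&& adj g (pe u) (pe v), ~~ common_nbr predT h (pc u) (pc v)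
    & ~~ common_nbr (fun c => maxn (pe u) (pe v) < c)%N g (pe u) (pe v)].

Definition two_bite pe pc g h u v := kept pe pc g h u v || kept pc pe h g u v.

Lemma common_nbrC (P : pred 'I_m) g a b : common_nbr P g a b = common_nbr P g b a.
Proof. by apply: eq_existsb => c; rewrite [adj g c a && _]andbC. Qed.

Lemma keptC pe pc g h u v : kept pe pc g h u v = kept pe pc g h v u.
Proof.
by rewrite /kept adjC maxnC; congr [&& _, ~~ _ & ~~ _]; exact: common_nbrC.
Qed.

Lemma kept_adj pe pc g h u v : kept pe pc g h u v -> adj g (pe u) (pe v).
Proof. by case/and3P. Qed.

Lemma kept_mixed pe pc g h u v w :
  kept pe pc g h u w -> kept pe pc g h v w -> ~~ kept pc pe h g u v.
Proof.
move=> /kept_adj uw /kept_adj vw; apply/negP => /and3P[_ /existsP + _]; apply.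
by exists (pe w); rewrite /= ![adj g (pe w) _]adjC uw vw.
Qed.

Lemma kept_le_max pe pc g h u v w :
  kept pe pc g h u v -> kept pe pc g h u w -> kept pe pc g h v w ->
  (pe w <= maxn (pe u) (pe v))%N.
Proof.
move=> /and3P[_ _ /existsP not_above] /kept_adj uw /kept_adj vw.
rewrite leqNgt; apply/negP => above; apply: not_above; exists (pe w).
by rewrite above ![adj g (pe w) _]adjC uw vw.
Qed.

Lemma kept_mono pe pc g h u v w :
  kept pe pc g h u v -> kept pe pc g h v w -> ~~ kept pe pc g h u w.
Proof.
move=> uv vw; apply/negP => uw.
have le_w := kept_le_max uv uw vw.
have le_v : (pe v <= maxn (pe u) (pe w))%N by apply: (kept_le_max uw uv); rewrite keptC.
have le_u : (pe u <= maxn (pe v) (pe w))%N by apply: (kept_le_max vw); rewrite keptC.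
have ne x y : kept pe pc g h x y -> pe x != pe y :> nat by move/kept_adj/andP=> [].
have := ne _ _ uv; have := ne _ _ vw; have := ne _ _ uw; lia.
Qed.

Lemma two_biteC pe pc g h u v : two_bite pe pc g h u v = two_bite pe pc g h v u.
Proof. by rewrite /two_bite keptC [kept pc _ _ _ _ _]keptC. Qed.

Lemma two_bite_irr pe pc g h u : two_bite pe pc g h u u = false.
Proof. by rewrite /two_bite /kept !adj_irr. Qed.

Lemma two_bite_triangle_free pe pc g h u v w :
  two_bite pe pc g h u v -> two_bite pe pc g h v w -> ~~ two_bite pe pc g h u w.
Proof.
have mixed pe' pc' g' h' x y z : kept pe' pc' g' h' x y -> kept pe' pc' g' h' y z ->
    ~~ kept pc' pe' h' g' x z.
  by move=> xy yz; apply: (kept_mixed xy); rewrite keptC.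
have mixed_last pe' pc' g' h' x y z : kept pe' pc' g' h' x y -> kept pc' pe' h' g' y z ->
    ~~ kept pe' pc' g' h' x z && ~~ kept pc' pe' h' g' x z.
  move=> xy yz; apply/andP; split; apply: contraL yz => xz.
    by rewrite (mixed _ _ _ _ _ x) // keptC.
  by apply: contraL xy => yz; rewrite keptC (kept_mixed yz).
case/orP=> uv /orP[] vw; rewrite /two_bite negb_or.
- by rewrite (kept_mono uv vw) (mixed _ _ _ _ _ v).
- exact: mixed_last uv vw.
- by rewrite andbC; exact: mixed_last uv vw.
- by rewrite (kept_mono uv vw) (mixed _ _ _ _ _ v).
Qed.

Definition label pe pc I (a : 'I_m) : 'I_m :=
  if [pick u in I | pe u == a] is Some u then pc u else a.

Lemma labelP pe pc I a : a \in pe @: I ->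
  exists u, [/\ u \in I, pe u = a & label pe pc I a = pc u].
Proof.
case/imsetP=> u uI au; rewrite /label; case: pickP => [w /andP[wI /eqP]|/(_ u)].
  by exists w.
by rewrite uI au eqxx.
Qed.

Lemma label_imset pe pc I a : a \in pe @: I -> label pe pc I a \in pc @: I.
Proof. by case/(labelP pc)=> u [uI _ ->]; apply: imset_f. Qed.

Lemma card_label_le pe pc I (P : pred 'I_m) :
  (#|[set a in pe @: I | P (label pe pc I a)]| <= #|[set u in I | P (pc u)]|)%N.
Proof.
apply: leq_trans (leq_imset_card pe [set u in I | P (pc u)]); apply: subset_leq_card.
apply/subsetP => a; rewrite inE => /andP[/(labelP pc)[u [uI ua ->]] Pu].
by apply/imsetP; exists u; rewrite // inE uI.
Qed.

Lemma label_cover pe pc I (N : {set 'I_m}) :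
  (#|[set a in pe @: I | label pe pc I a \in N]| + #|pc @: I| <= #|I| + #|N|)%N.
Proof.
apply: (@leq_trans (#|[set u in I | pc u \in N]| + #|pc @: I|)).
  by rewrite leq_add2r (card_label_le pe pc I (mem N)).
rewrite -(cardsID [set u | pc u \in N] I) -addnA leq_add //.
  by apply: subset_leq_card; apply/subsetP => u; rewrite !inE.
apply: (@leq_trans #|N :|: pc @: (I :\: [set u | pc u \in N])|).
  apply: subset_leq_card; apply/subsetP => b /imsetP[u uI ->].
  rewrite inE; case: (boolP (pc u \in N)) => //= uN.
  by apply/imsetP; exists u; rewrite // !inE uN.
apply: leq_trans (leq_card_setU _ _) _; rewrite addnC leq_add2r.
exact: leq_imset_card.
Qed.

Lemma closed_pair_of_not_kept pe pc g h I :
  {in I &, forall u v, ~~ kept pe pc g h u v} ->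
  forall e, e \in pairs (pe @: I) -> g e -> closed_pair (label pe pc I) g h e.
Proof.
move=> not_kept e; rewrite inE => /and3P[].
move=> /(labelP pc)[u [uI ua la]] /(labelP pc)[v [vI vc lc]] ac ge.
have := not_kept u v uI vI; rewrite /kept ua vc adj_pair // ge /= -negb_or negbK.
by rewrite (maxn_idPr (ltnW ac)) /closed_pair la lc.
Qed.

End TwoBite.

(** * The union bound over independent sets *)

(* A block is light when at most [light_cut] labels are adjacent to it, and heavy
   when more than [heavy_cut] are. The caps bound: [block_cap] the fibers of the
   projections, [degree_cap] and [codegree_cap] the degrees and codegrees of the
   reduced graphs, [nonlight_cap] and [heavy_cap] the number of blocks that are
   not light and that are heavy, [nbhd_cap] the number of vertices in a
   neighbourhood, [edge_cap] the edges inside an independent set, [light_cap] the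
   pairs closed by light blocks, [closed_cap] all lightly closed pairs and
   [closed_edge_cap] the edges among these. The rates are exponents in moment
   generating functions. *)
Record parameters (R : realType) := TwoBiteParameters {
  edge_prob : R;
  block_cap : nat;
  degree_cap : nat;
  codegree_cap : nat;
  nonlight_cap : nat;
  heavy_cap : nat;
  light_cut : R;
  heavy_cut : R;
  nbhd_cap : R;
  edge_cap : R;
  light_cap : R;
  closed_cap : R;
  closed_edge_cap : R;
  uncovered_rate : R;
  closed_rate : R;
  light_rate : R;
  nbhd_rate : R }.

Definition overlap_cap (R : realType) (c : parameters R) :=
  (codegree_cap c * block_cap c)%N.

Record admissible (R : realType) (k : nat) (c : parameters R) : Prop := Admissible {
  edge_prob01 : 0 <= edge_prob c <= 1;
  light_cut_ge0 : 0 <= light_cut c;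
  light_cut_le_heavy : light_cut c <= heavy_cut c;
  nbhd_cap_ge0 : 0 <= nbhd_cap c;
  nonlight_cap_large :
    k%:R + (nonlight_cap c ^ 2 * overlap_cap c)%:R <= (nonlight_cap c)%:R * light_cut c;
  heavy_cap_large :
    k%:R + (heavy_cap c ^ 2 * overlap_cap c)%:R <= (heavy_cap c)%:R * heavy_cut c;
  closed_cap_large :
    (k * block_cap c)%:R +
    (light_cap c + 2 * light_cut c * (block_cap c)%:R * edge_cap c) +
    heavy_cut c * (k + nonlight_cap c ^ 2 * overlap_cap c)%:R +
    (light_cap c + 2 * (degree_cap c)%:R * edge_cap c) <= closed_cap c;
  uncovered_rate_ge0 : 0 <= uncovered_rate c;
  closed_rate_ge0 : 0 <= closed_rate c;
  light_rate_ge0 : 0 <= light_rate c;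
  light_rate_block : light_rate c * light_cut c * (block_cap c)%:R <= 2^-1;
  light_rate_set : light_rate c * light_cut c * k%:R * edge_prob c <= 2^-1;
  light_rate_degree : light_rate c * (degree_cap c)%:R <= 2^-1;
  light_rate_degree_set :
    light_rate c * (degree_cap c)%:R * k%:R * edge_prob c <= 2^-1;
  nbhd_rate_gt0 : 0 < nbhd_rate c;
  nbhd_rate_block : nbhd_rate c * (block_cap c)%:R <= 2^-1 }.

Section UnionBound.
Variables (R : realType) (V : finType) (m k : nat) (c : parameters R).
Hypotheses (k_gt0 : (0 < k)%N) (c_ok : admissible k c).
Implicit Types (g h : graph m) (pe pc : V -> 'I_m) (I : {set V}).

Let p01 := edge_prob01 c_ok.
Local Notation random_graph := (random_graph m p01).
Local Notation random_graphs := (prod_distr random_graph random_graph).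

Definition bounded_fibers pc := forall b, (#|fiber [set: V] pc b| <= block_cap c)%N.

Definition exceptional pe pc I g h :=
  let J := pe @: I in let J' := pc @: I in let lab := label pe pc I in
  [|| light_cap c <= outer_light_cherries J lab J' (light_cut c) h,
      edge_cap c <= #|edges_in h J'|%:R,
      light_cap c <= outer_light_cherries J id J (degree_cap c)%:R g,
      edge_cap c <= #|edges_in g J|%:R
    | (#|[set e | lightly_closed J lab (heavy_cut c) g h e]|%:R <= closed_cap c) &&
      (closed_edge_cap c <=
         #|[set e | lightly_closed J lab (heavy_cut c) g h e && g e]|%:R)].

Definition light_bound : R := expR (light_rate c *
  (m%:R * (16 * (k%:R * edge_prob c) ^+ 2) - light_cap c)).
Definition edge_bound : R := expR (3 / 2 * edge_prob c * k%:R ^+ 2 - edge_cap c).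
Definition closed_edge_bound : R :=
  expR (edge_prob c * (expR (closed_rate c) - 1) * closed_cap c -
        closed_rate c * closed_edge_cap c).
Definition exceptional_bound : R :=
  2 * light_bound + 2 * edge_bound + closed_edge_bound.

Lemma card_fiber_label pe pc I b : bounded_fibers pc ->
  (#|fiber (pe @: I) (label pe pc I) b| <= block_cap c)%N.
Proof.
move=> pcS; apply: leq_trans (pcS b).
apply: leq_trans (card_label_le pe pc I (pred1 b)) _; apply: subset_leq_card.
by apply/subsetP => u; rewrite !inE => /andP[].
Qed.

Lemma outer_light_cherries_tail (J J' : {set 'I_m}) lab (S : nat) (D : R) :
  (forall a, a \in J -> lab a \in J') -> (#|J| <= k)%N ->
  (forall b, #|fiber J lab b| <= S)%N -> 0 <= D ->
  light_rate c * D * S%:R <= 2^-1 -> light_rate c * D * k%:R * edge_prob c <= 2^-1 ->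
  Pr random_graph (fun h => light_cap c <= outer_light_cherries J lab J' D h) <=
  light_bound.
Proof.
move=> lab_J' J_k fiberS D0 rate_S rate_k.
apply: (light_wcherry_tail _ (vmax := S%:R)) => //; last exact: light_rate_ge0 c_ok.
- by move=> b; rewrite fiber_weight_ge0 /= ler_nat.
- by rewrite sum_fiber_weight1 // ler_nat.
Qed.

Lemma edges_in_image_tail (J : {set 'I_m}) : (#|J| <= k)%N ->
  Pr random_graph (fun g => edge_cap c <= #|edges_in g J|%:R) <= edge_bound.
Proof.
move=> J_k; apply: le_trans (edges_in_tail _ _ _) _; rewrite ler_expR lerD2r.
rewrite ler_wpM2l ?lerXn2r ?nnegrE ?ler_nat // mulr_ge0 ?divr_ge0 //.
by case/andP: p01.
Qed.

Lemma exceptional_tail pe pc I : #|I| = k -> bounded_fibers pc ->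
  Pr random_graphs (fun z => exceptional pe pc I z.1 z.2) <= exceptional_bound.
Proof.
move=> Ik pcS; rewrite /exceptional /=.
set J := pe @: I; set J' := pc @: I; set lab := label pe pc I.
have im_k (pi : V -> 'I_m) : (#|pi @: I| <= k)%N by rewrite -Ik leq_imset_card.
apply: (@le_trans _ _
  (light_bound + (edge_bound + (light_bound + (edge_bound + closed_edge_bound))))).
  apply: PrU_le; [|apply: PrU_le; [|apply: PrU_le; [|apply: PrU_le]]].
  - apply: Pr_prod_distr_le2 => g.
    apply: (outer_light_cherries_tail (S := block_cap c)).
    + by move=> a; exact: label_imset.
    + exact: im_k.
    + by move=> b; exact: card_fiber_label.
    + exact: light_cut_ge0 c_ok.
    + exact: light_rate_block c_ok.
    + exact: light_rate_set c_ok.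
  - by apply: Pr_prod_distr_le2 => g; exact: edges_in_image_tail (im_k _).
  - apply: Pr_prod_distr_le1 => h.
    apply: (outer_light_cherries_tail (S := 1)) => //.
    + exact: im_k.
    + by move=> b; exact: card_fiber_id.
    + by rewrite mulr1; exact: light_rate_degree c_ok.
    + exact: light_rate_degree_set c_ok.
  - by apply: Pr_prod_distr_le1 => h; exact: edges_in_image_tail (im_k _).
  - apply: Pr_prod_distr_le1 => h.
    apply: (predictable_tail _ (ht := fun e : 'I_m * 'I_m => e.2 : nat)).
      exact: closed_rate_ge0 c_ok.
    by move=> e; exact: lightly_closed_predictable.
rewrite /exceptional_bound; lra.
Qed.

Definition typical pc g :=
  [&& [forall b, #|nbr g b| <= degree_cap c]%N,
      [forall b, #|lnbr [set: V] pc g b|%:R <= nbhd_cap c]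
    & [forall b, forall b', (b != b') ==> (codeg g b b' <= codegree_cap c)%N]].

Definition atypical_bound : R :=
  m%:R * expR (3 * edge_prob c * m%:R - (degree_cap c)%:R) +
  m%:R * expR (nbhd_rate c * (edge_prob c * #|V|%:R *
    (1 + 2 * (nbhd_rate c * (block_cap c)%:R)) - nbhd_cap c)) +
  m%:R ^+ 2 * expR (3 * edge_prob c ^+ 2 * m%:R - (codegree_cap c)%:R).

Lemma atypical_tail pc : bounded_fibers pc ->
  Pr random_graph (fun g => ~~ typical pc g) <= atypical_bound.
Proof.
move=> pcS.
pose large_deg g := [exists b, degree_cap c <= #|nbr g b|]%N.
pose large_nbhd g := [exists b, nbhd_cap c <= #|lnbr [set: V] pc g b|%:R].
pose large_codeg g :=
  [exists b : 'I_m * 'I_m, (b.1 != b.2) && (codegree_cap c <= codeg g b.1 b.2)%N].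
apply: (@le_trans _ _ (Pr random_graph (fun g =>
    (large_deg g || large_nbhd g) || large_codeg g))).
  apply: ler_Pr => g; rewrite /typical !negb_and !negb_forall -orbA.
  case/or3P=> /existsP[b]; rewrite ?negb_forall -?ltnNge -?ltNge.
  - by move=> /ltnW hb; apply/or3P/Or31/existsP; exists b.
  - by move=> /ltW hb; apply/or3P/Or32/existsP; exists b.
  - case/existsP=> b'; rewrite negb_imply -ltnNge => /andP[bb' /ltnW hb].
    by apply/or3P/Or33/existsP; exists (b, b'); rewrite bb'.
apply: PrU_le; first apply: PrU_le.
- rewrite -[m in m%:R * _]card_ord; apply: Pr_exists_le_card => b.
  by apply: le_trans (deg_tail p01 b _); apply: ler_Pr => g; rewrite ler_nat.
- rewrite -[m in m%:R * _]card_ord; apply: Pr_exists_le_card => b; rewrite -(cardsT V).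
  exact: lnbr_tail (nbhd_rate_gt0 c_ok) (nbhd_rate_block c_ok).
rewrite -[m in m%:R ^+ 2]card_ord expr2 -natrM -card_prod; apply: Pr_exists_le_card => b.
case: eqVneq => [_|bb'] /=.
  by rewrite /Pr (@eq_Ex _ _ _ _ (fun=> 0)) // Ex_cst expR_ge0.
by apply: le_trans (codeg_tail p01 _ bb'); apply: ler_Pr => g; rewrite ler_nat.
Qed.

Definition indep_in pe pc I g h :=
  [forall u in I, forall v in I, ~~ two_bite pe pc g h u v].

Definition covered_bound (j : nat) : R :=
  nbhd_cap c / 2 * (k%:R - j%:R + (heavy_cap c * degree_cap c)%:R +
    (heavy_cap c ^ 2 * overlap_cap c)%:R).

Definition few_uncovered_in pe pc I g :=
  few_uncovered (pe @: I) (label pe pc I) (heavy_cap c) (degree_cap c)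
    (covered_bound #|pc @: I|) (closed_edge_cap c) g.

Lemma exceptional_or_few_uncovered pe pc I g h : #|I| = k -> bounded_fibers pc ->
  typical pe g -> typical pc h -> {in I &, forall u v, ~~ kept pe pc g h u v} ->
  exceptional pe pc I g h || few_uncovered_in pe pc I g.
Proof.
move=> Ik pcS /and3P[/forallP gdeg _ _].
move=> /and3P[/forallP hdeg /forallP hnbhd /forallP hcodeg] not_kept.
rewrite /exceptional /few_uncovered_in /=.
set J := pe @: I; set J' := pc @: I; set lab := label pe pc I.
case: lerP => //= light_h; case: lerP => //= edges_h.
case: lerP => //= light_g; case: lerP => //= edges_g.
have lab_J' a : a \in J -> lab a \in J' by exact: label_imset.
have J_k : (#|J| <= k)%N by rewrite -Ik leq_imset_card.
have J_gt0 : (0 < #|J|)%N by rewrite card_gt0 imset_eq0 -card_gt0 Ik.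
have fiberS b : (#|fiber J lab b| <= block_cap c)%N by exact: card_fiber_label.
have J_cover (N : {set 'I_m}) : (#|[set a in J | lab a \in N]| + #|J'| <= k + #|N|)%N.
  by rewrite -Ik; exact: label_cover.
have codeg_le b b' : b != b' -> (codeg h b b' <= codegree_cap c)%N.
  by move=> bb'; have /forallP/(_ b')/implyP := hcodeg b; apply.
have lnbr_le b : #|lnbr J lab h b|%:R <= nbhd_cap c.
  apply: le_trans (hnbhd b); rewrite ler_nat.
  apply: leq_trans (card_label_le pe pc I (adj h b)) _; apply: subset_leq_card.
  by apply/subsetP => u; rewrite !inE => /andP[].
have closed_le := card_lightly_closed lab_J' J_gt0 J_k fiberS codeg_le gdeg
  (light_cut_ge0 c_ok) (light_cut_le_heavy c_ok) (nonlight_cap_large c_ok)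
  (ltW light_h) (ltW light_g) (ltW edges_h) (ltW edges_g).
rewrite (le_trans closed_le (closed_cap_large c_ok)) /=; case: lerP => //= closed_edges.
have [A [A_small A_covered A_closed]] := heavy_family J_gt0 J_k fiberS hdeg codeg_le
  J_cover (heavy_cap_large c_ok) (nbhd_cap_ge0 c_ok) lnbr_le.
apply/existsP; exists A; rewrite A_covered /=; apply/andP; split; first exact/forallP.
apply: le_trans (ltW closed_edges); rewrite ler_nat; apply: subset_leq_card.
apply/subsetP => e; rewrite !in_set => /andP[/andP[e_uncovered eJ] ge].
have ep : e \in pairs J by rewrite inE.
have := A_closed g e ep (closed_pair_of_not_kept not_kept ep ge).
by rewrite ge andbT !in_set (negPf e_uncovered) orbF.
Qed.

Definition few_uncovered_bound (j j' : nat) : R :=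
  ((m.+1 ^ degree_cap c) ^ heavy_cap c)%:R *
  expR (uncovered_rate c * closed_edge_cap c -
    edge_prob c * (1 - expR (- uncovered_rate c)) *
      ((j%:R ^+ 2 - j%:R) / 2 - covered_bound j')).

Definition side_bound (j : nat) : R := few_uncovered_bound j j.

Lemma few_uncovered_boundM j j' :
  few_uncovered_bound j j' * few_uncovered_bound j' j = side_bound j * side_bound j'.
Proof.
rewrite /side_bound /few_uncovered_bound mulrACA [RHS]mulrACA -!expRD.
by congr (_ * expR _); ring.
Qed.

Lemma typical_indep_tail pe pc I : #|I| = k -> bounded_fibers pe -> bounded_fibers pc ->
  Pr random_graphs
    (fun z => [&& typical pe z.1, typical pc z.2 & indep_in pe pc I z.1 z.2]) <=
  2 * exceptional_bound +
  side_bound #|pe @: I| * side_bound #|pc @: I|.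
Proof.
move=> Ik peS pcS; apply: (@le_trans _ _ (Pr random_graphs (fun z =>
   (exceptional pe pc I z.1 z.2 || exceptional pc pe I z.2 z.1) ||
   (few_uncovered_in pe pc I z.1 && few_uncovered_in pc pe I z.2)))).
  apply: ler_Pr => -[g h] /= /and3P[tg th /forall_inP ind].
  have not_two_bite u v : u \in I -> v \in I ->
      ~~ kept pe pc g h u v /\ ~~ kept pc pe h g u v.
    by move=> uI vI; have /forall_inP/(_ v vI) := ind u uI; rewrite negb_or => /andP.
  have := exceptional_or_few_uncovered Ik pcS tg th
    (fun u v uI vI => (not_two_bite u v uI vI).1).
  have := exceptional_or_few_uncovered Ik peS th tg
    (fun u v uI vI => (not_two_bite u v uI vI).2).
  by case: exceptional; case: exceptional => //= -> ->.
rewrite mulr_natl mulr2n; apply: PrU_le; first apply: PrU_le.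
- exact: exceptional_tail.
- by rewrite /Pr Ex_prod_distrC; exact: exceptional_tail.
rewrite (Pr_prod_distrM _ _ (few_uncovered_in pe pc I) (few_uncovered_in pc pe I)).
rewrite -few_uncovered_boundM; apply: ler_pM; rewrite ?Pr_ge0 //;
  by apply: few_uncovered_tail; exact: uncovered_rate_ge0 c_ok.
Qed.

Lemma exists_two_bite_graphs pe pc : bounded_fibers pe -> bounded_fibers pc ->
  2 * atypical_bound + 'C(#|V|, k)%:R * (2 * exceptional_bound) +
  \sum_(I : {set V} | #|I| == k)
    side_bound #|pe @: I| * side_bound #|pc @: I| < 1 ->
  exists g h, forall I, #|I| = k -> ~~ indep_in pe pc I g h.
Proof.
move=> peS pcS lt1.
pose bad_set z I := [&& typical pe z.1, typical pc z.2 & indep_in pe pc I z.1 z.2].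
have [|[g h]] := @Pr_lt1 _ _ random_graphs (fun z =>
    (~~ typical pe z.1 || ~~ typical pc z.2) ||
    [exists (I : {set V} | #|I| == k), bad_set z I]).
  apply: le_lt_trans lt1; rewrite -addrA; apply: PrU_le.
    rewrite mulr_natl mulr2n; apply: PrU_le.
      by apply: Pr_prod_distr_le1 => h; exact: atypical_tail.
    by apply: Pr_prod_distr_le2 => g; exact: atypical_tail.
  rewrite binE_card_sets mulr_natl -sumr_const -big_split /=.
  apply: le_trans (_ : \sum_(I : {set V} | #|I| == k)
    Pr random_graphs (bad_set^~ I) <= _).
    by apply: Pr_exists_le => z /existsP[I /andP[Ik badI]]; exists I.
  by apply: ler_sum => I /eqP Ik; exact: typical_indep_tail.
rewrite !negb_or => /andP[/andP[/negPn /= tg /negPn /= th] no_bad]; exists g, h => I Ik.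
apply: contraNN no_bad => ind; apply/existsP; exists I.
by rewrite Ik eqxx /bad_set tg th.
Qed.

End UnionBound.

(** * Random projections *)

Section Uniform.
Variables (R : realFieldType) (T : finType).
Hypothesis T_gt0 : (0 < #|T|)%N.

Let uniform_mass (t : T) : R := #|T|%:R^-1.

Lemma uniform_mass_ge0 t : 0 <= uniform_mass t.
Proof. by rewrite invr_ge0. Qed.

Lemma uniform_mass_sum1 : \sum_t uniform_mass t = 1.
Proof. by rewrite sumr_const -[_ *+ _]mulr_natr mulVf // pnatr_eq0 -lt0n. Qed.

Definition uniform := Distr uniform_mass_ge0 uniform_mass_sum1.

Lemma Ex_uniform f : Ex uniform f = (\sum_t f t) / #|T|%:R.
Proof. by rewrite /Ex -mulr_sumr mulrC. Qed.

End Uniform.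

Section Projections.
Variables (R : realType) (V B : finType) (k : nat).
Hypothesis B_gt0 : (0 < #|B|)%N.
Implicit Types (I : {set V}) (J : {set B}).

Definition random_map : distr R {ffun V -> B} := ffun_distr V (uniform R B_gt0).

Lemma imset_sub_Pr I J :
  Pr random_map (fun pi => pi @: I \subset J) = (#|J|%:R / #|B|%:R) ^+ #|I|.
Proof.
rewrite /Pr (@eq_Ex _ _ _ _
    (fun pi : {ffun V -> B} => \prod_(u in I) (pi u \in J)%:R)); last first.
  move=> pi; case: (boolP (pi @: I \subset J)) => [/subsetP sub|/subsetPn[a]].
    by rewrite big1 // => u uI; rewrite sub // imset_f.
  by case/imsetP=> u uI -> /negPf nJ; rewrite (bigD1 u) //= nJ mul0r.
rewrite (Ex_prod_coord _ (fun _ a => (a \in J)%:R)); last exact: in2W.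
rewrite -prodr_const; apply: eq_bigr => u _; rewrite Ex_uniform; congr (_ / _).
by rewrite card_sum_mem natr_sum.
Qed.

Section ImageSize.
Variable phi : nat -> R.
Hypothesis phi_ge0 : forall j, 0 <= phi j.

Definition image_bound : R :=
  \sum_(j < k.+1) phi j * ('C(#|B|, j)%:R * (j%:R / #|B|%:R) ^+ k).

Lemma image_bound_ge0 : 0 <= image_bound.
Proof. by apply: sumr_ge0 => j _; rewrite !mulr_ge0 ?exprn_ge0 ?divr_ge0. Qed.

Lemma Ex_image_size I : #|I| = k ->
  Ex random_map (fun pi => phi #|pi @: I|) <= image_bound.
Proof.
move=> Ik; pose covers j (pi : {ffun V -> B}) : R :=
  \sum_(J : {set B} | #|J| == j) (pi @: I \subset J)%:R.
have covers_ge0 j pi : 0 <= covers j pi by apply: sumr_ge0.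
apply: (@le_trans _ _ (Ex random_map (fun pi => \sum_(j < k.+1) phi j * covers j pi))).
  apply: ler_Ex => pi.
  have im_k : (#|pi @: I| < k.+1)%N by rewrite ltnS -Ik leq_imset_card.
  rewrite (bigD1 (Ordinal im_k)) //= -[leLHS]addr0 lerD //; last first.
    by apply: sumr_ge0 => j _; rewrite mulr_ge0.
  rewrite -[leLHS]mulr1 ler_wpM2l // /covers (bigD1 (pi @: I)) //= subxx lerDl.
  exact: sumr_ge0.
rewrite Ex_sum; apply: ler_sum => j _; rewrite ExZ ler_wpM2l // Ex_sum.
under eq_bigr => J /eqP Jj do rewrite -[Ex _ _]/(Pr _ _) imset_sub_Pr Jj Ik.
by rewrite sumr_const -[leLHS]mulr_natl -card_draws cardsE.
Qed.

End ImageSize.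

Lemma fiber_tail b (x : R) :
  Pr random_map (fun pi => x <= #|fiber [set: V] pi b|%:R) <=
  expR (3 * #|V|%:R / #|B|%:R - x).
Proof.
have fiberE (pi : {ffun V -> B}) :
    #|fiber [set: V] pi b|%:R = \sum_u (pi u == b)%:R :> R.
  by rewrite (natr_card_set _ (mem [set: V])); apply: eq_bigl => u; rewrite /= inE.
apply: le_trans (Pr_chernoff _ _ _) _; rewrite addrC expRD ler_wpM2l ?expR_ge0 //.
under eq_Ex do rewrite fiberE expR_sum.
rewrite (Ex_prod_coord _ (fun _ a => expR (a == b)%:R)); last by [].
rewrite mulrAC expRM_natr -prodr_const; apply: ler_prod => u _.
rewrite Ex_ge0 => [|a]; last exact: expR_ge0.
apply: le_trans (expR_ge1Dx _); rewrite Ex_uniform (bigD1 b) //= eqxx.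
rewrite (eq_bigr (fun=> 1)) => [|a /negPf ->]; last exact: expR0.
rewrite ler_pdivrMr ?ltr0n // mulrDl mul1r divfK ?pnatr_eq0 -?lt0n //.
have : \sum_(a | a != b) 1 = #|B|%:R - 1 :> R.
  by rewrite -[#|B|%:R]sumr_const [\sum_(_ in _) _](bigD1 b) //= addrAC subrr add0r.
by have := expR1_le4 R; lra.
Qed.

Lemma exists_balanced_maps (S : nat) (phi : nat -> R) : (forall j, 0 <= phi j) ->
  2 * (#|B|%:R * expR (3 * #|V|%:R / #|B|%:R - S%:R)) +
    2 * ('C(#|V|, k)%:R * image_bound phi ^+ 2) < 1 ->
  exists pe pc : {ffun V -> B},
    [/\ forall b, (#|fiber [set: V] pe b| <= S)%N,
        forall b, (#|fiber [set: V] pc b| <= S)%N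
      & \sum_(I : {set V} | #|I| == k) phi #|pe @: I| * phi #|pc @: I| <= 2^-1].
Proof.
move=> phi_ge0 lt1; pose random_maps := prod_distr random_map random_map.
pose large_fiber (pi : {ffun V -> B}) := [exists b, S <= #|fiber [set: V] pi b|]%N.
pose total (z : {ffun V -> B} * {ffun V -> B}) :=
  \sum_(I : {set V} | #|I| == k) phi #|z.1 @: I| * phi #|z.2 @: I|.
have large_fiber_tail : Pr random_map large_fiber <=
    #|B|%:R * expR (3 * #|V|%:R / #|B|%:R - S%:R).
  apply: Pr_exists_le_card => b; apply: le_trans (fiber_tail b _).
  by apply: ler_Pr => pi; rewrite ler_nat.
have total_tail : Pr random_maps (fun z => 2^-1 <= total z) <=
    2 * ('C(#|V|, k)%:R * image_bound phi ^+ 2).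
  apply: le_trans (_ : Ex random_maps (fun z => 2 * total z) <= _).
    apply: Pr_markov => z; last by lra.
    by rewrite mulr_ge0 // sumr_ge0 // => I _; rewrite mulr_ge0.
  rewrite ExZ ler_wpM2l // Ex_sum binE_card_sets mulr_natl -sumr_const.
  apply: ler_sum => I /eqP Ik.
  rewrite (Ex_prod_distrM _ _ (fun pe : {ffun V -> B} => phi #|pe @: I|)
    (fun pc : {ffun V -> B} => phi #|pc @: I|)).
  by rewrite expr2 ler_pM ?Ex_ge0 ?Ex_image_size.
have [|[pe pc]] := @Pr_lt1 _ _ random_maps (fun z =>
    (large_fiber z.1 || large_fiber z.2) || (2^-1 <= total z)).
  apply: le_lt_trans lt1; rewrite [2 * (#|B|%:R * _)]mulr_natl mulr2n.
  apply: PrU_le total_tail; apply: PrU_le.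
    by apply: Pr_prod_distr_le1 => pc.
  by apply: Pr_prod_distr_le2 => pe.
rewrite !negb_or -ltNge => /andP[/andP[/= pe_small pc_small] /ltW total_le].
have bounded pi : ~~ large_fiber pi -> forall b, (#|fiber [set: V] pi b| <= S)%N.
  move=> small b; apply: contraNT small; rewrite -ltnNge => /ltnW b_large.
  by apply/existsP; exists b.
by exists pe, pc; split=> //; exact: bounded.
Qed.

End Projections.

(** * Choice of the parameters *)

(* The quadratic is minimal at [a = 0.415], with value above [0.517]. *)
Lemma union_exponent_le (R : realFieldType) (a tail kinv err linv : R) :
  0 <= a -> a <= 1 -> 0 <= tail -> tail <= 200^-1 -> 0 <= kinv -> kinv <= 1000^-1 ->
  0 <= err -> err <= 1000^-1 -> linv <= 1000^-1 ->
  linv + 8 / 1000 -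
    (1 - tail) * (5 / 8 * ((1 - a) ^+ 2 - (1 - a) * kinv - 43 / 100 * (a + err))) +
    linv - 999 / 1000 * a <= - (501 / 1000).
Proof.
move=> a0 a1 z0 z1 i0 i1 e0 e1 l1.
set Y := (1 - a) ^+ 2 - (1 - a) * kinv - 43 / 100 * (a + err).
have a_kinv : 0 <= (1 - a) * kinv <= 1000^-1.
  rewrite mulr_ge0 ?subr_ge0 //=.
  apply: (@le_trans _ _ (1 * kinv)); last by rewrite mul1r.
  by rewrite ler_wpM2r //; lra.
have Y_le1 : Y <= 1.
  have : (1 - a) ^+ 2 <= 1 by rewrite expr2; nra.
  by rewrite /Y; lra.
have tailY : tail * Y <= 200^-1.
  by apply: (@le_trans _ _ (tail * 1)); [exact: ler_wpM2l | rewrite mulr1].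
have := sqr_ge0 (a - 415 / 1000); move: tailY a_kinv; rewrite /Y !expr2; lra.
Qed.

Lemma expRN8_le (R : realType) : expR (- 8) <= 200^-1 :> R.
Proof.
rewrite expRN lef_pV2 ?posrE ?expR_gt0 //.
apply: le_trans (expR_ge1Dxn 4 (ler0n R 8)); rewrite !factS fact0; lra.
Qed.

Lemma le_truncn1 (R : archiRealDomainType) (x : R) : x <= (Num.truncn x)%:R + 1.
Proof. by rewrite natr1; exact/ltW/truncnS_gt. Qed.

Section Choice.
Variables (R : realType) (k : nat).
Local Notation K := (k%:R : R).
Local Notation L := (ln K).

(* Small enough for [closed_rate], which must be large compared to
   [K * L / closed_edge_cap]. *)
Definition heavy_density : R := expR (- 4000) / 9.
Local Notation u := heavy_density.

Definition block_count : nat := Num.truncn (K ^+ 2 / L ^+ 4).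

Definition two_bite_parameters : parameters R := {|
  edge_prob := 5 / 4 * L / K;
  block_cap := Num.truncn (4 * L ^+ 3);
  degree_cap := Num.truncn (5 * K / L ^+ 3);
  codegree_cap := Num.truncn (7 * L);
  nonlight_cap := Num.truncn (3 * L ^+ 5);
  heavy_cap := Num.truncn (L / 1000);
  light_cut := K / L ^+ 5;
  heavy_cut := u * K;
  nbhd_cap := 43 / 100 * K;
  edge_cap := 6 * K * L;
  light_cap := u * K ^+ 2;
  closed_cap := 7 * (u * K ^+ 2);
  closed_edge_cap := K * L / 1000;
  uncovered_rate := 8;
  closed_rate := 4000;
  light_rate := 6 * L / (u * K);
  nbhd_rate := (400 * L ^+ 3)^-1 |}.
Local Notation c := two_bite_parameters.

Definition sufficiently_large :=
  [/\ 10 ^+ 5 <= u * L, L ^+ 20 <= K & 2 * L ^+ 4 <= expR (L / 1000)].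

Lemma heavy_density_gt0 : 0 < u.
Proof. by rewrite divr_gt0 ?expR_gt0. Qed.

Lemma heavy_densityE : expR 4000 * u = 9^-1.
Proof. by rewrite mulrA expRxMexpNx_1 mul1r. Qed.

Lemma heavy_density_le1 : u <= 1.
Proof.
have e1 : expR (- 4000) <= 1 :> R by rewrite expR_le1 oppr_le0.
rewrite /heavy_density; lra.
Qed.

Section Large.
Hypothesis k_large : sufficiently_large.

Let u_ge0 : 0 <= u. Proof. exact/ltW/heavy_density_gt0. Qed.
Let u_neq0 : u != 0. Proof. exact/lt0r_neq0/heavy_density_gt0. Qed.
#[local] Hint Resolve heavy_density_gt0 u_ge0 u_neq0 : core.

Lemma log_ge : 10 ^+ 5 <= L.
Proof.
case: k_large => uL _ _; have := heavy_density_le1; have := heavy_density_gt0.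
by rewrite leNgt => u0 u1; apply/negP => Llt; move: uL; nra.
Qed.

Lemma log_gt0 : 0 < L. Proof. by have := log_ge; lra. Qed.

Let L_ge0 : 0 <= L. Proof. exact: ltW log_gt0. Qed.
Let L_neq0 : L != 0. Proof. exact: lt0r_neq0 log_gt0. Qed.
Let exprL_gt0 i : 0 < L ^+ i. Proof. exact: exprn_gt0 log_gt0. Qed.
Let exprL_ge0 i : 0 <= L ^+ i. Proof. exact: ltW. Qed.
#[local] Hint Resolve log_gt0 L_ge0 L_neq0 exprL_gt0 exprL_ge0 : core.

Lemma exprL_le i j : (i <= j)%N -> L ^+ i <= L ^+ j.
Proof. by move=> ij; rewrite ler_weXn2l //; have := log_ge; lra. Qed.

Lemma k_gt0 : (0 < k)%N.
Proof.
by case: k_large => _ L20 _; rewrite -(ltr_nat R); apply: lt_le_trans L20.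
Qed.

Let K_gt0 : 0 < K. Proof. by rewrite ltr0n k_gt0. Qed.
Let K_neq0 : K != 0. Proof. exact: lt0r_neq0. Qed.
#[local] Hint Resolve K_gt0 K_neq0 : core.

Lemma expR_log : expR L = K. Proof. by rewrite lnK ?posrE. Qed.

Lemma exprL_le_k i : (i <= 20)%N -> L ^+ i <= K.
Proof. by case: k_large => _ L20 _ /exprL_le/le_trans; exact. Qed.

Lemma k_ge1 : 1 <= K. Proof. exact: (exprL_le_k (leq0n 20)). Qed.

Lemma polylog_le (x : R) i : x <= 10 ^+ 5 -> (i < 20)%N -> x * L ^+ i <= K.
Proof.
move=> x_le i20; apply: le_trans (exprL_le_k i20).
by rewrite exprS ler_wpM2r //; apply: le_trans log_ge.
Qed.

Lemma heavy_densityM_log_ge i : (0 < i)%N -> 10 ^+ 5 <= u * L ^+ i.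
Proof.
case: k_large => uL _ _ i0; apply: le_trans uL _; rewrite ler_pM2l //.
exact: exprL_le i0.
Qed.

Lemma div_heavy_density_log_le (x : R) i :
  (0 < i)%N -> x <= 5 * 10 ^+ 4 -> x / (u * L ^+ i) <= 2^-1.
Proof.
move=> i0 x_le; rewrite ler_pdivrMr; last exact: mulr_gt0.
by have := heavy_densityM_log_ge i0; lra.
Qed.

Lemma block_count_le : block_count%:R * L ^+ 4 <= K ^+ 2.
Proof. by rewrite -ler_pdivlMr // truncn_le divr_ge0 ?sqr_ge0. Qed.

Lemma block_count_ge : K ^+ 2 <= 2 * (block_count%:R * L ^+ 4).
Proof.
have K2 : 1 * L ^+ 4 <= K ^+ 2.
  by rewrite expr2; apply: ler_pM => //; [exact: k_ge1 | exact: exprL_le_k].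
have m_ge : K ^+ 2 / L ^+ 4 <= block_count%:R + 1 by exact: le_truncn1.
have m_gt0 : 1 <= block_count%:R :> R.
  by rewrite -[1]/(1%:R) ler_nat truncn_gt_nat ler_pdivlMr.
by rewrite mulrA -ler_pdivrMr //; lra.
Qed.

Lemma block_count_gt0 : (0 < block_count)%N.
Proof.
rewrite lt0n; apply: contraTneq block_count_ge => ->.
by rewrite mul0r mulr0 -ltNge exprn_gt0.
Qed.

Lemma block_cap_le : (block_cap c)%:R <= 4 * L ^+ 3.
Proof. by rewrite truncn_le mulr_ge0. Qed.

Lemma block_cap_ge : 3 * L ^+ 3 <= (block_cap c)%:R.
Proof.
have : 4 * L ^+ 3 <= (block_cap c)%:R + 1 by exact: le_truncn1.
have := exprL_le (leq0n 3); rewrite expr0; lra.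
Qed.

Lemma degree_cap_le : (degree_cap c)%:R <= 5 * K / L ^+ 3.
Proof. by rewrite truncn_le divr_ge0 ?mulr_ge0. Qed.

Lemma degree_cap_ge : 5 * K / L ^+ 3 <= (degree_cap c)%:R + 1.
Proof. exact: le_truncn1. Qed.

Lemma codegree_cap_le : (codegree_cap c)%:R <= 7 * L.
Proof. by rewrite truncn_le mulr_ge0. Qed.

Lemma codegree_cap_ge : 7 * L <= (codegree_cap c)%:R + 1.
Proof. exact: le_truncn1. Qed.

Lemma nonlight_cap_le : (nonlight_cap c)%:R <= 3 * L ^+ 5.
Proof. by rewrite truncn_le mulr_ge0. Qed.

Lemma nonlight_cap_ge : 2 * L ^+ 5 <= (nonlight_cap c)%:R.
Proof.
have : 3 * L ^+ 5 <= (nonlight_cap c)%:R + 1 by exact: le_truncn1.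
have := exprL_le (leq0n 5); rewrite expr0; lra.
Qed.

Lemma heavy_cap_le : (heavy_cap c)%:R <= L / 1000.
Proof. by rewrite truncn_le divr_ge0. Qed.

Lemma heavy_cap_ge : 2 <= (heavy_cap c)%:R * u.
Proof.
have : L / 1000 <= (heavy_cap c)%:R + 1 by exact: le_truncn1.
move/(ler_wpM2r u_ge0); have := heavy_density_le1; case: k_large; lra.
Qed.

Lemma overlap_cap_le : (overlap_cap c)%:R <= 28 * L ^+ 4.
Proof.
rewrite natrM; apply: le_trans (ler_pM _ _ codegree_cap_le block_cap_le) _ => //.
by rewrite le_eqVlt; apply/orP; left; apply/eqP; ring.
Qed.

Lemma edge_probM_k : edge_prob c * K = 5 / 4 * L.
Proof. by rewrite /= divfK. Qed.

Lemma edge_prob_ge0 : 0 <= edge_prob c.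
Proof. by rewrite /= !(mulr_ge0, invr_ge0). Qed.

Lemma edge_prob_le1 : edge_prob c <= 1.
Proof. by rewrite /= ler_pdivrMr // mul1r -[L]expr1 polylog_le //; lra. Qed.

Lemma light_cut_le_heavy_cut : light_cut c <= heavy_cut c.
Proof.
rewrite /= ler_pdivrMr // mulrAC ler_peMl //.
by have := @heavy_densityM_log_ge 5 isT; lra.
Qed.

Lemma card_overlap_le j : (j <= nonlight_cap c)%N -> (j ^ 2 * overlap_cap c)%:R <= K.
Proof.
rewrite -(ler_nat R) => j_le; rewrite natrM natrX.
apply: (@le_trans _ _ ((3 * L ^+ 5) ^+ 2 * (28 * L ^+ 4))).
  rewrite ler_pM ?exprn_ge0 ?overlap_cap_le // lerXn2r ?nnegrE ?mulr_ge0 //.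
  exact: le_trans nonlight_cap_le.
have -> : (3 * L ^+ 5) ^+ 2 * (28 * L ^+ 4) = 252 * L ^+ 14 by ring.
by apply: polylog_le => //; lra.
Qed.

Lemma heavy_cap_le_nonlight_cap : (heavy_cap c <= nonlight_cap c)%N.
Proof.
rewrite -(ler_nat R); apply: le_trans heavy_cap_le _; apply: le_trans nonlight_cap_ge.
have := @exprL_le 1 5 isT; rewrite expr1; have := L_ge0; lra.
Qed.

Lemma nonlight_count_le :
  k%:R + (nonlight_cap c ^ 2 * overlap_cap c)%:R <= (nonlight_cap c)%:R * light_cut c.
Proof.
apply: (@le_trans _ _ (2 * K)); first by have := card_overlap_le (leqnn _); lra.
by rewrite [light_cut c]/= mulrA ler_pdivlMr // mulrAC ler_pM2r // nonlight_cap_ge.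
Qed.

Lemma heavy_count_le :
  k%:R + (heavy_cap c ^ 2 * overlap_cap c)%:R <= (heavy_cap c)%:R * heavy_cut c.
Proof.
apply: (@le_trans _ _ (2 * K)).
  by have := card_overlap_le heavy_cap_le_nonlight_cap; lra.
by rewrite [heavy_cut c]/= mulrA ler_pM2r // heavy_cap_ge.
Qed.

Lemma same_label_le : (k * block_cap c)%:R <= u * K ^+ 2.
Proof.
rewrite natrM expr2 mulrCA ler_pM2l //; apply: le_trans block_cap_le _.
have uL4 : u * (4 * L ^+ 4) <= u * K by rewrite ler_wpM2l // polylog_le //; lra.
have := ler_wpM2r (exprL_ge0 3) (@heavy_densityM_log_ge 1 isT).
have := exprL_ge0 3; lra.
Qed.

Lemma light_cutM_block_cap_le : light_cut c * (block_cap c)%:R <= 4 * K / L ^+ 2.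
Proof.
apply: (@le_trans _ _ (light_cut c * (4 * L ^+ 3))).
  by rewrite ler_wpM2l ?block_cap_le // divr_ge0.
by rewrite /= le_eqVlt; apply/orP; left; apply/eqP; field.
Qed.

Lemma closed_count_le :
  (k * block_cap c)%:R +
  (light_cap c + 2 * light_cut c * (block_cap c)%:R * edge_cap c) +
  heavy_cut c * (k + nonlight_cap c ^ 2 * overlap_cap c)%:R +
  (light_cap c + 2 * (degree_cap c)%:R * edge_cap c) <= closed_cap c.
Proof.
have edge_cap_ge0 : 0 <= edge_cap c by rewrite /= !mulr_ge0.
have K2_gt0 : 0 < K ^+ 2 by rewrite exprn_gt0.
have light_le : 2 * light_cut c * (block_cap c)%:R * edge_cap c <= u * K ^+ 2.
  apply: (@le_trans _ _ (2 * (4 * K / L ^+ 2) * edge_cap c)).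
    by rewrite ler_wpM2r // -mulrA ler_wpM2l // light_cutM_block_cap_le.
  have -> : 2 * (4 * K / L ^+ 2) * edge_cap c = 48 / L * K ^+ 2 by rewrite /=; field.
  by rewrite ler_pM2r // ler_pdivrMr //; have := @heavy_densityM_log_ge 1 isT; lra.
have heavy_le : heavy_cut c * (k + nonlight_cap c ^ 2 * overlap_cap c)%:R <=
    2 * (u * K ^+ 2).
  rewrite natrD [heavy_cut c]/=; apply: (@le_trans _ _ (u * K * (K + K))).
    by rewrite ler_wpM2l ?lerD2l ?card_overlap_le // mulr_ge0.
  by rewrite expr2; lra.
have own_le : 2 * (degree_cap c)%:R * edge_cap c <= u * K ^+ 2.
  apply: (@le_trans _ _ (2 * (5 * K / L ^+ 3) * edge_cap c)).
    by rewrite ler_wpM2r // ler_wpM2l // degree_cap_le.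
  have -> : 2 * (5 * K / L ^+ 3) * edge_cap c = 60 / L ^+ 2 * K ^+ 2 by rewrite /=; field.
  by rewrite ler_pM2r // ler_pdivrMr //; have := @heavy_densityM_log_ge 2 isT; lra.
have := same_label_le; rewrite [light_cap c]/= [closed_cap c]/=; lra.
Qed.

Let light_rate0 : 0 <= light_rate c.
Proof. by rewrite /= divr_ge0 // mulr_ge0. Qed.

Lemma light_rateM_block_le : light_rate c * light_cut c * (block_cap c)%:R <= 2^-1.
Proof.
rewrite -mulrA; apply: (@le_trans _ _ (light_rate c * (4 * K / L ^+ 2))).
  by rewrite ler_wpM2l ?light_cutM_block_cap_le.
have -> : light_rate c * (4 * K / L ^+ 2) = 24 / (u * L ^+ 1).
  by rewrite /=; field; rewrite u_neq0 L_neq0 K_neq0.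
by apply: div_heavy_density_log_le => //; lra.
Qed.

Lemma light_rateM_set_le : light_rate c * light_cut c * k%:R * edge_prob c <= 2^-1.
Proof.
have -> : light_rate c * light_cut c * k%:R * edge_prob c = 15 / 2 / (u * L ^+ 3).
  by rewrite /=; field; rewrite u_neq0 L_neq0 K_neq0.
by apply: div_heavy_density_log_le => //; lra.
Qed.

Lemma light_rateM_degree_le : light_rate c * (degree_cap c)%:R <= 2^-1.
Proof.
apply: (@le_trans _ _ (light_rate c * (5 * K / L ^+ 3))).
  by rewrite ler_wpM2l ?degree_cap_le.
have -> : light_rate c * (5 * K / L ^+ 3) = 30 / (u * L ^+ 2).
  by rewrite /=; field; rewrite u_neq0 L_neq0 K_neq0.
by apply: div_heavy_density_log_le => //; lra.
Qed.

Lemma light_rateM_degree_set_le :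
  light_rate c * (degree_cap c)%:R * k%:R * edge_prob c <= 2^-1.
Proof.
rewrite -mulrA [K * _]mulrC edge_probM_k.
apply: (@le_trans _ _ (light_rate c * (5 * K / L ^+ 3) * (5 / 4 * L))).
  apply: ler_wpM2r; first by rewrite mulr_ge0 ?divr_ge0.
  by rewrite ler_wpM2l ?degree_cap_le.
have -> : light_rate c * (5 * K / L ^+ 3) * (5 / 4 * L) = 75 / 2 / (u * L ^+ 1).
  by rewrite /=; field; rewrite u_neq0 L_neq0 K_neq0.
by apply: div_heavy_density_log_le => //; lra.
Qed.

Lemma nbhd_rateM_block_cap_le : nbhd_rate c * (block_cap c)%:R <= 100^-1.
Proof.
rewrite [nbhd_rate c]/= mulrC ler_pdivrMr ?mulr_gt0 //.
by have := block_cap_le; lra.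
Qed.

Lemma two_bite_parameters_admissible : admissible k c.
Proof.
have edge_prob_itv : 0 <= edge_prob c <= 1 by rewrite edge_prob_ge0 edge_prob_le1.
split.
- exact: edge_prob_itv.
- by rewrite /= divr_ge0.
- exact: light_cut_le_heavy_cut.
- by rewrite /= mulr_ge0 ?divr_ge0.
- exact: nonlight_count_le.
- exact: heavy_count_le.
- exact: closed_count_le.
- by [].
- by [].
- exact: light_rate0.
- exact: light_rateM_block_le.
- exact: light_rateM_set_le.
- exact: light_rateM_degree_le.
- exact: light_rateM_degree_set_le.
- by rewrite /= invr_gt0 mulr_gt0.
- by apply: le_trans nbhd_rateM_block_cap_le _; lra.
Qed.

Section VertexSet.
Variable V : finType.
Hypothesis V_small : #|V|%:R * (3 * L) <= K ^+ 2.
Local Notation m := block_count.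

Let KL_gt0 : 0 < K * L. Proof. by rewrite mulr_gt0. Qed.
#[local] Hint Resolve KL_gt0 : core.

Lemma light_bound_le : light_bound m k c <= expR (- (3 * (K * L))).
Proof.
have -> : - (3 * (K * L)) = light_rate c * (- (u * K ^+ 2 / 2)).
  by rewrite /=; field; rewrite u_neq0 K_neq0.
rewrite ler_expR ler_wpM2l // [K * edge_prob c]mulrC edge_probM_k [light_cap c]/=.
have -> : m%:R * (16 * (5 / 4 * L) ^+ 2) = 25 / L ^+ 2 * (m%:R * L ^+ 4) by field.
have pairs_le : 25 / L ^+ 2 * (m%:R * L ^+ 4) <= 25 / L ^+ 2 * K ^+ 2.
  by rewrite ler_wpM2l ?block_count_le // divr_ge0.
have K2_le : 25 / L ^+ 2 * K ^+ 2 <= u / 2 * K ^+ 2.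
  rewrite ler_pM2r ?exprn_gt0 // ler_pdivrMr //.
  by have := @heavy_densityM_log_ge 2 isT; lra.
lra.
Qed.

Lemma edge_bound_le : edge_bound k c <= expR (- (3 * (K * L))).
Proof.
rewrite ler_expR (_ : 3 / 2 * edge_prob c * K ^+ 2 = 3 / 2 * (edge_prob c * K) * K).
  by rewrite edge_probM_k [edge_cap c]/=; have := KL_gt0; lra.
by rewrite expr2; ring.
Qed.

Lemma closed_edge_bound_le : closed_edge_bound c <= expR (- (3 * (K * L))).
Proof.
rewrite ler_expR (_ : edge_prob c * _ * _ =
    (edge_prob c * K) * K * 7 * ((expR 4000 - 1) * u)); last by rewrite /=; ring.
rewrite edge_probM_k mulrBl heavy_densityE mul1r.
have : 5 / 4 * L * K * 7 * (9^-1 - u) <= 5 / 4 * L * K * 7 * 9^-1.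
  by apply: ler_wpM2l; rewrite ?lerBlDr ?lerDl //; have := KL_gt0; lra.
rewrite [closed_rate c]/= [closed_edge_cap c]/=; have := KL_gt0; lra.
Qed.

Lemma exceptional_bound_le : exceptional_bound m k c <= 5 * expR (- (3 * (K * L))).
Proof.
rewrite /exceptional_bound.
have := light_bound_le; have := edge_bound_le; have := closed_edge_bound_le; lra.
Qed.

Lemma block_count_le_expR : m%:R <= expR (2 * L) / 2.
Proof.
rewrite expRM_natl expR_log.
have L4 : 2 <= L ^+ 4.
  by apply: le_trans (@exprL_le 1 4 isT); have := log_ge; lra.
have : m%:R * 2 <= m%:R * L ^+ 4 by rewrite ler_wpM2l.
by have := block_count_le; lra.
Qed.

Lemma block_countM_expR_le (x : R) : x <= - (3 * L) -> m%:R * expR x <= L^-1.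
Proof.
move=> x_le; apply: (@le_trans _ _ (expR (2 * L) * expR x)).
  rewrite ler_wpM2r ?expR_ge0 //; apply: le_trans block_count_le_expR _.
  by have := expR_ge0 (2 * L); lra.
rewrite -expRD; apply: le_trans (expRN_leV log_gt0); rewrite ler_expR; lra.
Qed.

Lemma log_le_k_div_log3 (x : R) : x <= 10 ^+ 5 -> x * L <= K / L ^+ 3.
Proof. by move=> x_le; rewrite ler_pdivlMr // -mulrA -exprS polylog_le. Qed.

Lemma large_degree_bound_le :
  m%:R * expR (3 * edge_prob c * m%:R - (degree_cap c)%:R) <= L^-1.
Proof.
apply: block_countM_expR_le.
have mean_le : 3 * edge_prob c * m%:R <= 15 / 4 * (K / L ^+ 3).
  have -> : 3 * edge_prob c * m%:R = 15 / 4 * (m%:R * L ^+ 4 / (K * L ^+ 3)).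
    by rewrite /=; field; rewrite L_neq0 K_neq0.
  rewrite ler_pM2l ?divr_gt0 // ler_pdivrMr ?mulr_gt0 //.
  by have -> : K / L ^+ 3 * (K * L ^+ 3) = K ^+ 2; [field | exact: block_count_le].
have cap_ge : 5 * (K / L ^+ 3) <= (degree_cap c)%:R + 1 by rewrite mulrA degree_cap_ge.
have : 4 * L <= K / L ^+ 3 by apply: log_le_k_div_log3; lra.
have := log_ge; lra.
Qed.

Lemma large_nbhd_bound_le :
  m%:R * expR (nbhd_rate c * (edge_prob c * #|V|%:R *
    (1 + 2 * (nbhd_rate c * (block_cap c)%:R)) - nbhd_cap c)) <= L^-1.
Proof.
apply: block_countM_expR_le.
have nbhd_rate0 : 0 <= nbhd_rate c by rewrite /= invr_ge0 mulr_ge0.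
have mean_le : edge_prob c * #|V|%:R <= 5 / 12 * K.
  have -> : edge_prob c * #|V|%:R = 5 / 12 * (#|V|%:R * (3 * L) / K) by rewrite /=; field.
  by rewrite ler_pM2l ?divr_gt0 // ler_pdivrMr // -expr2.
have nbhd_le : edge_prob c * #|V|%:R * (1 + 2 * (nbhd_rate c * (block_cap c)%:R)) <=
    5 / 12 * K * (1 + 2 / 100).
  apply: ler_pM => //; first by rewrite mulr_ge0 ?edge_prob_ge0.
    by rewrite addr_ge0 // !mulr_ge0.
  by have := nbhd_rateM_block_cap_le; lra.
apply: (@le_trans _ _ (nbhd_rate c * - (5 / 1000 * K))).
  by rewrite ler_wpM2l // [nbhd_cap c]/=; lra.
have -> : nbhd_rate c * - (5 / 1000 * K) = - (K / L ^+ 3) / (8 * 10 ^+ 4).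
  by rewrite /=; field.
have : 24 * 10 ^+ 4 * L <= K / L ^+ 3.
  rewrite ler_pdivlMr // (_ : _ * L * L ^+ 3 = 24 * 10 ^+ 4 * L ^+ 4); last by ring.
  apply: (@le_trans _ _ (10 ^+ 5 * L ^+ 5)).
    by have := ler_wpM2r (exprL_ge0 4) log_ge; have := exprL_ge0 4; lra.
  exact: polylog_le.
lra.
Qed.

Lemma large_codegree_bound_le :
  m%:R ^+ 2 * expR (3 * edge_prob c ^+ 2 * m%:R - (codegree_cap c)%:R) <= L^-1.
Proof.
have mean_le : 3 * edge_prob c ^+ 2 * m%:R <= 3.
  have -> : 3 * edge_prob c ^+ 2 * m%:R = 75 / 16 * (m%:R * L ^+ 4) / (K ^+ 2 * L ^+ 2).
    by rewrite /=; field; rewrite L_neq0 K_neq0.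
  rewrite ler_pdivrMr ?mulr_gt0 ?exprn_gt0 //.
  have L2 : 2 <= L ^+ 2.
    by apply: le_trans (@exprL_le 1 2 isT); have := log_ge; lra.
  have := ler_wpM2l (sqr_ge0 K) L2; have := sqr_ge0 K; have := block_count_le; lra.
apply: (@le_trans _ _ (expR (4 * L) * expR (- (5 * L)))).
  apply: ler_pM; rewrite ?expR_ge0 ?sqr_ge0 //.
    have -> : 4 * L = 2%:R * (2 * L) by ring.
    rewrite expRM_natl; apply: lerXn2r; rewrite ?nnegrE ?expR_ge0 //.
    by apply: le_trans block_count_le_expR _; have := expR_ge0 (2 * L); lra.
  by rewrite ler_expR; have := codegree_cap_ge; have := log_ge; lra.
by rewrite -expRD; apply: le_trans (expRN_leV log_gt0); rewrite ler_expR; lra.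
Qed.

Lemma atypical_bound_le : atypical_bound V m c <= 3 / L.
Proof.
rewrite /atypical_bound; have := large_degree_bound_le.
have := large_nbhd_bound_le; have := large_codegree_bound_le; lra.
Qed.

Lemma bin_card_le : 'C(#|V|, k)%:R <= expR (K * L).
Proof.
apply: le_trans (bin_le_expR R #|V| k_gt0) _.
have -> : expR K = expR 1 ^+ k by rewrite -expRM_natl mulr1.
rewrite -exprMn expRM_natl expR_log.
apply: lerXn2r; rewrite ?nnegrE ?mulr_ge0 ?expR_ge0 ?invr_ge0 //.
apply: (@le_trans _ _ (#|V|%:R / K * 4)).
  by rewrite ler_wpM2l ?expR1_le4 // divr_ge0.
rewrite mulrAC ler_pdivrMr // -expr2; apply: le_trans V_small.
by rewrite ler_wpM2l //; have := log_ge; lra.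
Qed.

Lemma exceptional_total_le : 'C(#|V|, k)%:R * (2 * exceptional_bound m k c) <= 10^-1.
Proof.
apply: (@le_trans _ _ (expR (K * L) * (2 * (5 * expR (- (3 * (K * L))))))).
  apply: ler_pM => //; last by rewrite ler_pM2l // exceptional_bound_le.
    by rewrite mulr_ge0 // !addr_ge0 ?mulr_ge0 ?expR_ge0.
  exact: bin_card_le.
have -> : expR (K * L) * (2 * (5 * expR (- (3 * (K * L))))) =
    10 * expR (- (2 * (K * L))).
  have -> : - (2 * (K * L)) = K * L + - (3 * (K * L)) by ring.
  by rewrite expRD; ring.
have KL_ge : 100 <= K * L.
  by apply: le_trans (ler_peMl L_ge0 k_ge1); have := log_ge; lra.
have : expR (- (2 * (K * L))) <= (2 * (K * L))^-1 by apply: expRN_leV; lra.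
have : (2 * (K * L))^-1 <= 100^-1 by rewrite lef_pV2 ?posrE //; lra.
lra.
Qed.

Lemma failure_bound_lt_half :
  2 * atypical_bound V m c + 'C(#|V|, k)%:R * (2 * exceptional_bound m k c) < 2^-1.
Proof.
have := atypical_bound_le; have := exceptional_total_le.
have : 3 / L <= 10^-1 by rewrite ler_pdivrMr //; have := log_ge; lra.
lra.
Qed.

Lemma covered_error_le :
  (heavy_cap c * degree_cap c)%:R + (heavy_cap c ^ 2 * overlap_cap c)%:R <= K / 1000.
Proof.
have degree_le : (heavy_cap c * degree_cap c)%:R <= K / 2000.
  rewrite natrM; apply: (@le_trans _ _ (L / 1000 * (5 * K / L ^+ 3))).
    by apply: ler_pM; rewrite ?heavy_cap_le ?degree_cap_le.
  have -> : L / 1000 * (5 * K / L ^+ 3) = K * (5 / 1000 / L ^+ 2) by field.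
  rewrite ler_pM2l // ler_pdivrMr //.
  by have := @exprL_le 1 2 isT; have := log_ge; rewrite expr1; lra.
have overlap_le : (heavy_cap c ^ 2 * overlap_cap c)%:R <= K / 2000.
  rewrite natrM natrX; apply: (@le_trans _ _ (L ^+ 2 * (28 * L ^+ 4))).
    have : (heavy_cap c)%:R <= L by have := heavy_cap_le; have := L_ge0; lra.
    by move=> cap_L; rewrite ler_pM ?exprn_ge0 ?overlap_cap_le // lerXn2r ?nnegrE.
  have : 60 * 10 ^+ 3 * L ^+ 6 <= K by apply: polylog_le => //; lra.
  by have := exprL_ge0 6; lra.
lra.
Qed.

Lemma family_count_le : ((m.+1 ^ degree_cap c) ^ heavy_cap c)%:R <= expR (K / (100 * L)).
Proof.
rewrite -expnM natrX.
apply: (@le_trans _ _ (expR (2 * L) ^+ (degree_cap c * heavy_cap c))).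
  apply: lerXn2r; rewrite ?nnegrE ?expR_ge0 //.
  have : 1 + 2 * L <= expR (2 * L) by exact: expR_ge1Dx.
  by have := block_count_le_expR; have := log_ge; rewrite -[m.+1%:R]natr1; lra.
rewrite -expRM_natr ler_expR natrM.
apply: (@le_trans _ _ (2 * L * (5 * K / L ^+ 3 * (L / 1000)))).
  rewrite ler_wpM2l ?mulr_ge0 //.
  by apply: ler_pM; rewrite ?degree_cap_le ?heavy_cap_le.
by rewrite le_eqVlt; apply/orP; left; apply/eqP; field.
Qed.

Lemma image_size_prob_le (j : nat) : (0 < j)%N -> (j <= k)%N ->
  'C(m, j)%:R * (j%:R / m%:R) ^+ k <= expR (K - 999 / 1000 * L * (K - j%:R)).
Proof.
move=> j_gt0 jk; have jK : j%:R <= K by rewrite ler_nat.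
have m_gt0 : 0 < m%:R :> R by rewrite ltr0n block_count_gt0.
have j0 : 0 < j%:R :> R by rewrite ltr0n.
have jm0 : 0 <= j%:R / m%:R :> R by rewrite divr_ge0.
rewrite -{1}(subnKC jk) exprD mulrA expRD; apply: ler_pM; rewrite ?mulr_ge0 ?exprn_ge0 //.
  apply: le_trans (ler_wpM2r (exprn_ge0 _ jm0) (bin_le_expR R m j_gt0)) _.
  rewrite mulrAC -exprMn mulrA divfK ?gt_eqF // divff ?gt_eqF //.
  by rewrite expr1n mul1r ler_expR.
have -> : - (999 / 1000 * L * (K - j%:R)) = - (999 / 1000 * L) * (k - j)%:R.
  by rewrite natrB //; ring.
rewrite expRM_natr; apply: lerXn2r; rewrite ?nnegrE ?expR_ge0 //.
apply: (@le_trans _ _ (2 * L ^+ 4 / K)).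
  rewrite ler_pdivrMr // mulrAC ler_pdivlMr //.
  apply: (@le_trans _ _ (K * K)); first by rewrite ler_pM2r.
  by have := block_count_ge; rewrite expr2; lra.
apply: (@le_trans _ _ (expR (L / 1000) / K)).
  by rewrite ler_pM2r ?invr_gt0 //; case: k_large.
have -> : expR (L / 1000) / K = expR (L / 1000 - L) by rewrite expRD expRN expR_log.
by rewrite ler_expR; lra.
Qed.

Lemma side_bound_ge0 j : 0 <= side_bound m k c j.
Proof. by rewrite mulr_ge0 ?expR_ge0. Qed.

Lemma side_boundM_prob_le (j : nat) : (0 < j)%N -> (j <= k)%N ->
  side_bound m k c j * ('C(m, j)%:R * (j%:R / m%:R) ^+ k) <=
  expR (- (501 / 1000) * (K * L)).
Proof.
move=> j_gt0 jk; have jK : j%:R <= K by rewrite ler_nat.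
pose a := (K - j%:R) / K.
pose er := ((heavy_cap c * degree_cap c)%:R + (heavy_cap c ^ 2 * overlap_cap c)%:R) / K.
have a_ge0 : 0 <= a by rewrite divr_ge0 // subr_ge0.
have a_le1 : a <= 1 by rewrite ler_pdivrMr // mul1r gerBl.
have er_ge0 : 0 <= er by rewrite divr_ge0 // addr_ge0.
have er_le : er <= 1000^-1 by rewrite ler_pdivrMr // mulrC covered_error_le.
have inv_le (x : R) : 1000 <= x -> x^-1 <= 1000^-1.
  by move=> x_ge; rewrite lef_pV2 ?posrE //; apply: lt_le_trans x_ge.
have iL : L^-1 <= 1000^-1 by apply: inv_le; have := log_ge; lra.
have iK : K^-1 <= 1000^-1.
  by apply: inv_le; rewrite -[leLHS]mulr1 -(expr0 L) polylog_le //; lra.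
have iK_ge0 : 0 <= K^-1 by rewrite invr_ge0.
have exponent_le := union_exponent_le a_ge0 a_le1 (expR_ge0 _) (expRN8_le R)
  iK_ge0 iK er_ge0 er_le iL.
apply: (@le_trans _ _ (expR (K / (100 * L)) *
    expR (8 * (K * L / 1000) - K * L * ((1 - expR (- 8)) *
      (5 / 8 * ((1 - a) ^+ 2 - (1 - a) * K^-1 - 43 / 100 * (a + er))))) *
    expR (K * L * (L^-1 - 999 / 1000 * a)))).
  apply: ler_pM; rewrite ?side_bound_ge0 ?mulr_ge0 ?exprn_ge0 ?divr_ge0 //.
    apply: ler_pM; rewrite ?expR_ge0 ?family_count_le //.
    rewrite ler_expR le_eqVlt; apply/orP; left; apply/eqP.
    by rewrite /covered_bound /er /a /=; field.
  apply: le_trans (image_size_prob_le j_gt0 jk) _; rewrite ler_expR le_eqVlt.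
  by apply/orP; left; apply/eqP; rewrite /a; field; rewrite K_neq0 L_neq0.
rewrite -!expRD ler_expR.
have family_le : K / (100 * L) <= K * L * L^-1.
  rewrite mulfK // ler_pdivrMr ?mulr_gt0 // ler_peMr //.
  by have := log_ge; lra.
move: family_le (ler_wpM2l (ltW KL_gt0) exponent_le); lra.
Qed.

Local Notation side := (side_bound m k c).

Lemma image_bound_le : image_bound 'I_m k side <= 2 * K * expR (- (501 / 1000) * (K * L)).
Proof.
apply: (@le_trans _ _ (\sum_(j < k.+1) expR (- (501 / 1000) * (K * L)))).
  apply: ler_sum => j _; rewrite card_ord; case: (posnP j) => [->|j_gt0].
    by rewrite mul0r expr0n gtn_eqF ?k_gt0 // !mulr0 expR_ge0.
  by apply: side_boundM_prob_le; rewrite // -ltnS.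
rewrite sumr_const card_ord -[_ *+ k.+1]mulr_natl ler_wpM2r ?expR_ge0 //.
by rewrite -natr1; have := k_ge1; lra.
Qed.

Lemma image_total_le : 'C(#|V|, k)%:R * image_bound 'I_m k side ^+ 2 <= 4 * L^-1.
Proof.
apply: (@le_trans _ _ (expR (K * L) * (2 * K * expR (- (501 / 1000) * (K * L))) ^+ 2)).
  apply: ler_pM; rewrite ?exprn_ge0 ?bin_card_le ?image_bound_ge0 //.
    exact: side_bound_ge0.
  apply: lerXn2r; rewrite ?nnegrE ?mulr_ge0 ?expR_ge0 ?image_bound_le //.
  by rewrite image_bound_ge0 //; exact: side_bound_ge0.
have -> : (2 * K * expR (- (501 / 1000) * (K * L))) ^+ 2 =
    4 * (expR (2%:R * L) * expR (2%:R * (- (501 / 1000) * (K * L)))).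
  by rewrite !expRM_natl expR_log; ring.
rewrite mulrCA -!expRD ler_pM2l //; apply: le_trans (expRN_leV log_gt0).
rewrite ler_expR.
have : 10 ^+ 5 * L <= K * L by rewrite ler_pM2r // -[leLHS]mulr1 -(expr0 L) polylog_le.
have := log_gt0; lra.
Qed.

Lemma large_fiber_bound_le :
  m%:R * expR (3 * #|V|%:R / m%:R - (block_cap c)%:R) <= L^-1.
Proof.
apply: block_countM_expR_le.
have mean_le : 3 * #|V|%:R / m%:R <= 2 * L ^+ 3.
  rewrite ler_pdivrMr ?ltr0n ?block_count_gt0 // -(ler_pM2r log_gt0).
  by have := V_small; have := block_count_ge; lra.
have : 3 * L <= L ^+ 2 by rewrite expr2 ler_pM2r //; have := log_ge; lra.
have := @exprL_le 2 3 isT; have := block_cap_ge; lra.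
Qed.

Lemma projection_bound_lt1 :
  2 * (#|'I_m|%:R * expR (3 * #|V|%:R / #|'I_m|%:R - (block_cap c)%:R)) +
  2 * ('C(#|V|, k)%:R * image_bound 'I_m k side ^+ 2) < 1.
Proof.
rewrite card_ord; have := large_fiber_bound_le; have := image_total_le.
have : L^-1 <= 100^-1 by rewrite lef_pV2 ?posrE //; have := log_ge; lra.
lra.
Qed.

Lemma exists_two_bite_graph : exists pe pc : V -> 'I_m, exists g h : graph m,
  forall I : {set V}, #|I| = k -> ~~ indep_in pe pc I g h.
Proof.
have blocks_gt0 : (0 < #|'I_m|)%N by rewrite card_ord block_count_gt0.
have [pe [pc [peS pcS total_le]]] :=
  exists_balanced_maps blocks_gt0 side_bound_ge0 projection_bound_lt1.
exists pe, pc; apply: (exists_two_bite_graphs k_gt0 two_bite_parameters_admissible) => //.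
by have := failure_bound_lt_half; lra.
Qed.

End VertexSet.
End Large.
End Choice.

Lemma eventually_sufficiently_large (R : realType) :
  exists K0 : nat, forall k : nat, (K0 <= k)%N -> sufficiently_large R k.
Proof.
have [x20 x20_ge0 exp20] := expR_ge_exprn R 20.
have [x5 x5_ge0 exp5] := expR_ge_exprn R 5.
have u_gt0 := heavy_density_gt0 R.
have u_inv_ge0 : 0 <= 10 ^+ 5 / heavy_density R by rewrite divr_ge0 ?exprn_ge0 // ltW.
have p5_gt0 : 0 < 1000 ^+ 5 :> R by rewrite exprn_gt0.
pose B : R := 10 ^+ 5 / heavy_density R + x20 + 1000 * x5 + 2 * 1000 ^+ 5.
exists (Num.truncn (expR B)).+1 => k large_k.
have expB_lt : expR B < k%:R.
  by apply: lt_le_trans (truncnS_gt _) _; rewrite ler_nat.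
have k_gt0 : 0 < k%:R :> R by apply: le_lt_trans expB_lt; exact: expR_ge0.
have kE : k%:R = expR (ln k%:R) :> R by rewrite lnK ?posrE.
have : B < ln k%:R by rewrite -ltr_expR -kE.
rewrite /sufficiently_large /B; set L := ln k%:R => L_gt; split.
- by rewrite mulrC -ler_pdivrMr //; lra.
- by rewrite kE -/L; apply: exp20; lra.
have /(le_trans _) -> // : (L / 1000) ^+ 5 <= expR (L / 1000).
  by apply: exp5; rewrite ler_pdivlMr //; lra.
rewrite expr_div_n ler_pdivlMr // mulrAC [L ^+ 5]exprS ler_wpM2r ?exprn_ge0 //; lra.
Qed.

Lemma not_ramsey3_two_bite (R : realType) (n k : nat) : sufficiently_large R k ->
  n%:R * (3 * ln k%:R) <= k%:R ^+ 2 :> R -> ~ ramsey3 n k.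
Proof.
move=> k_large; rewrite -[n in n%:R]card_ord => n_small ramsey.
have [pe [pc [g [h dense]]]] := exists_two_bite_graph k_large n_small.
have two_bite_graph : simple_graph (two_bite pe pc g h).
  by split=> u; [move=> v; exact: two_biteC | exact: two_bite_irr].
case: (ramsey _ two_bite_graph) => [[u [v [w /and3P[uv vw uw]]]]|[I [indI Ik]]].
  by have := two_bite_triangle_free uv vw; rewrite uw.
have /negP := dense I Ik; apply; apply/forall_inP => u uI.
by apply/forall_inP => v; exact: indI.
Qed.

Lemma ramsey3_lower_bound (R : realType) :
  exists K0 : nat, forall k n : nat, (K0 <= k)%N -> ramsey3 n k ->
  0 < ln k%:R :> R /\ k%:R ^+ 2 / (3 * ln k%:R) <= n%:R :> R.
Proof.
have [K0 large] := eventually_sufficiently_large R.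
exists K0 => k n /large k_large ramsey; have log_k := log_gt0 k_large.
split=> //; rewrite leNgt; apply/negP => lt_n.
apply: (not_ramsey3_two_bite k_large) ramsey.
by rewrite -ler_pdivlMr ?mulr_gt0 // ltW.
Qed.

Lemma third_sub_eps_le (R : realFieldType) (eps x y : R) : 0 <= eps -> 0 <= x -> 0 < y ->
  (1 / 3 - eps) * x / y <= x / (3 * y).
Proof.
move=> eps0 x0 y0; rewrite invfM mulrA ler_pM2r ?invr_gt0 //.
by have := mulr_ge0 eps0 x0; lra.
Qed.

(* Imported only here: [Reals] rebinds [ln] and the scope key [R]. *)
From mathcomp Require Import Rstruct Rstruct_topology.
From Stdlib Require Import Reals.
Local Close Scope ring_scope.

Theorem theorem1p1 :
  forall eps : R, (0 < eps)%R ->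
  exists K : nat, forall k : nat, (K <= k)%N ->
    forall n : nat, ramsey3 n k ->
      ((1/3 - eps) * (INR k ^ 2) / ln (INR k) <= INR n)%R.
Proof.
move=> eps /RltP eps_gt0; have [K bound] := ramsey3_lower_bound Rdefinitions.R.
exists K => k k_large n /(bound _ _ k_large)[log_k_gt0 n_ge].
apply/RleP; rewrite !RealsE /=; apply: le_trans n_ge.
by apply: third_sub_eps_le => //; [exact: ltW | rewrite exprn_ge0].
Qed.
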